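(* Let $k$ be an infinite field, let $n\ge 4$ and let $A=\{0=a_0<a_1<\dots<a_{n-1}=d\}\subset\mathbb{N}$ with $\gcd(a_1,\dots,a_{n-1})=1$. The following statements are equivalent: (1) $\mathcal{C}_A$ is arithmetically Cohen-Macaulay, i.e., the ring $k[\mathcal{C}_A]$ is Cohen-Macaulay. (2) For all $i=1,\dots,d-1$, $(r_i,t_{d-i})\in\mathcal{S}$. In other words, if $q_1\in\operatorname{Ap}_1$, $q_2\in\operatorname{Ap}_2$ and $q_1+q_2\equiv0\pmod d$, then $(q_1,q_2)\in\operatorname{AP}_{\mathcal{S}}$. (3) $\operatorname{AP}_{\mathcal{S}}=\{(0,0)\}\cup\{(r_i,t_{d-i}):1\le i<d\}$. (4) $\operatorname{AP}_{\mathcal{S}}$ has exactly $d$ elements. (5) The exceptional set $E_{\mathcal{S}}$ is empty. (6) $\mathcal{S}'=\mathcal{S}$.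
   Context: $\mathbb{N}=\{0,1,2,\dots\}$. $k[\mathcal{C}_A]=k[x_0,\dots,x_{n-1}]/I(\mathcal{C}_A)$, where $I(\mathcal{C}_A)$ is the kernel of the $k$-algebra homomorphism $k[x_0,\dots,x_{n-1}]\to k[u,v]$, $x_i\mapsto u^{a_i}v^{d-a_i}$; it is the homogeneous coordinate ring of the projective monomial curve $\mathcal{C}_A\subset\mathbb{P}^{n-1}_k$. Let $\mathcal{S}_1,\mathcal{S}_2$ be the numerical semigroups generated by $A$ and by $d-A=\{d-a:a\in A\}$. For $j=1,2$, $\operatorname{Ap}_j=\{a\in\mathcal{S}_j:a-d\notin\mathcal{S}_j\}$ is a complete set of residues modulo $d$; write $\operatorname{Ap}_1=\{r_0=0,r_1,\dots,r_{d-1}\}$, $\operatorname{Ap}_2=\{t_0=0,t_1,\dots,t_{d-1}\}$ with $r_i\equiv t_i\equiv i\pmod d$. Let $\mathbf{a}_i=(a_i,d-a_i)\in\mathbb{N}^2$ (so $\mathbf{a}_0=(0,d)$, $\mathbf{a}_{n-1}=(d,0)$), let $\mathcal{S}\subset\mathbb{N}^2$ be the semigroup (with identity) generated by $\mathbf{a}_0,\dots,\mathbf{a}_{n-1}$, let $G\subset\mathbb{Z}^2$ be the group generated by $\mathcal{S}$, and $\mathcal{S}'=G\cap(\mathcal{S}_1\times\mathcal{S}_2)$. Define $\operatorname{AP}_{\mathcal{S}}=\{p\in\mathcal{S}: p-\mathbf{a}_0\notin\mathcal{S},\ p-\mathbf{a}_{n-1}\notin\mathcal{S}\}$ and $E_{\mathcal{S}}=\{p\in\mathcal{S}: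 p-\mathbf{a}_0\in\mathcal{S},\ p-\mathbf{a}_{n-1}\in\mathcal{S},\ p-\mathbf{a}_0-\mathbf{a}_{n-1}\notin\mathcal{S}\}$. *)

(* Defs.v *)
From HB Require Import structures.
From mathcomp Require Import all_boot all_order all_algebra.
From mathcomp Require Export mpoly.

Set Implicit Arguments.
Unset Strict Implicit.
Unset Printing Implicit Defensive.

Import Order.TTheory GRing.Theory Num.Theory.
Local Open Scope ring_scope.

Definition infinite_type (T : eqType) : Prop :=
  forall s : seq T, exists x : T, x \notin s.

(* Cohen-Macaulay rings, as in Eisenbud, "Commutative Algebra", Section 18.2:
   a noetherian commutative ring R is Cohen-Macaulay if depth P = codim P for
   every maximal ideal P of R.  Ideals are arbitrary subsets (R -> Prop), since
   the library's ideals are restricted to boolean predicates. *)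
Section CohenMacaulay.
Variable R : comNzRingType.
Implicit Types (I P : R -> Prop) (s : seq R).

Definition is_ideal I : Prop :=
  [/\ I 0, forall x y, I x -> I y -> I (x + y) & forall a x, I x -> I (a * x)].

Definition is_prime I : Prop :=
  [/\ is_ideal I, ~ I 1 & forall x y, I (x * y) -> I x \/ I y].

Definition is_maximal I : Prop :=
  [/\ is_ideal I, ~ I 1 &
      forall J : R -> Prop, is_ideal J -> ~ J 1 ->
        (forall x, I x -> J x) -> forall x, J x -> I x].

Definition ideal_gen s : R -> Prop :=
  fun x => exists c : nat -> R, x = \sum_(i < size s) c i * s`_i.

Definition noetherian : Prop :=
  forall I, is_ideal I -> exists s, forall x, I x <-> ideal_gen s x.

Definition regular_seq s : Prop :=
  ~ ideal_gen s 1 /\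
  forall i, (i < size s)%N ->
    forall y, ideal_gen (take i s) (s`_i * y) -> ideal_gen (take i s) y.

Definition has_depth P (r : nat) : Prop :=
  (exists s, [/\ size s = r, regular_seq s & forall x, x \in s -> P x]) /\
  (forall s, regular_seq s -> (forall x, x \in s -> P x) -> (size s <= r)%N).

Definition ideal_lt I J : Prop :=
  (forall x, I x -> J x) /\ exists x, J x /\ ~ I x.

(* Chains Q_0 < Q_1 < ... < Q_r = P of prime ideals. *)
Definition prime_chain P (r : nat) : Prop :=
  exists Q : nat -> R -> Prop,
    [/\ forall i, (i <= r)%N -> is_prime (Q i),
        forall i, (i < r)%N -> ideal_lt (Q i) (Q i.+1) &
        forall x, Q r x <-> P x].

Definition has_codim P (r : nat) : Prop :=
  prime_chain P r /\ forall r', prime_chain P r' -> (r' <= r)%N.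

Definition cohen_macaulay : Prop :=
  noetherian /\
  forall P, is_maximal P -> exists r, has_depth P r /\ has_codim P r.

End CohenMacaulay.

Section CoordinateRing.
Variables (k : fieldType) (n : nat) (A : n.-tuple nat) (d : nat).

Definition monomial_param : n.-tuple {mpoly k[2]} :=
  [tuple 'X_ord0 ^+ tnth A i * 'X_ord_max ^+ (d - tnth A i) | i < n].

Definition curve_ideal : {pred {mpoly k[n]}} :=
  fun p => p \mPo monomial_param == 0.

Fact curve_ideal_closed : idealr_closed curve_ideal.
Proof.
split=> [||c p q]; rewrite !unfold_in /curve_ideal; first by rewrite comp_mpoly0.
  by rewrite comp_mpoly1 oner_eq0.
by move=> /eqP p0 /eqP q0; rewrite rmorphD rmorphM /= p0 q0 mulr0 addr0.
Qed.

HB.instance Definition _ :=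
  isIdealr.Build {mpoly k[n]} curve_ideal curve_ideal_closed.

Definition coord_ring : comNzRingType := {ideal_quot curve_ideal}.

End CoordinateRing.

(* All semigroups are seen inside Z or Z^2, so that differences such as x - d
   are not truncated. *)
Section Generated.
Variables (V : zmodType) (n : nat) (g : 'I_n -> V).

Definition semigroup_gen : V -> Prop :=
  fun x => exists c : 'I_n -> nat, x = \sum_i g i *+ c i.

Definition group_gen : V -> Prop :=
  fun x => exists c : 'I_n -> int, x = \sum_i g i *~ c i.

End Generated.

Definition Apery (S : int -> Prop) (d : nat) : int -> Prop :=
  fun x => S x /\ ~ S (x - d%:Z).

(* r enumerates Apery S d as { r_0 = 0, ..., r_(d-1) } with r_i = i mod d;
   the values r i for d <= i are irrelevant. *)
Definition Apery_enum (S : int -> Prop) (d : nat) (r : nat -> int) : Prop :=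
  [/\ r 0%N = 0,
      forall i, (i < d)%N -> (r i = i%:Z %[mod d%:Z])%Z &
      forall x, Apery S d x <-> exists2 i, (i < d)%N & x = r i].

Section Semigroups.
Variables (n : nat) (A : n.-tuple nat) (d : nat).

Definition S1 : int -> Prop := semigroup_gen (fun i : 'I_n => (tnth A i)%:Z).
Definition S2 : int -> Prop :=
  semigroup_gen (fun i : 'I_n => d%:Z - (tnth A i)%:Z).

Definition vec (i : nat) : int * int :=
  ((nth 0%N A i)%:Z, d%:Z - (nth 0%N A i)%:Z).

Definition Sgp : int * int -> Prop := semigroup_gen (fun i : 'I_n => vec i).
Definition Ggp : int * int -> Prop := group_gen (fun i : 'I_n => vec i).
Definition Sgp' : int * int -> Prop := fun p => [/\ Ggp p, S1 p.1 & S2 p.2].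

Definition AP_S : int * int -> Prop :=
  fun p => [/\ Sgp p, ~ Sgp (p - vec 0) & ~ Sgp (p - vec n.-1)].

Definition E_S : int * int -> Prop :=
  fun p => [/\ Sgp p, Sgp (p - vec 0), Sgp (p - vec n.-1) &
               ~ Sgp (p - vec 0 - vec n.-1)].

End Semigroups.

(* Main.v *)
Require Import Defs.
From HB Require Import structures.
From mathcomp Require Import all_boot all_order all_algebra.
From mathcomp Require Import zify ring.
From mathcomp Require boolp classical_sets.
From Stdlib Require Import Classical.
Set Implicit Arguments.
Unset Strict Implicit.
Unset Printing Implicit Defensive.
Import Order.TTheory GRing.Theory Num.Theory.
Local Open Scope ring_scope.

(** The coordinate ring is the ring of polynomials in [k[u, v]] whose exponents
    lie in the semigroup, and the conditions other than Cohen-Macaulayness only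
    concern the semigroup.  The group generated by the semigroup consists of the
    points with coordinate sum divisible by [d], since the [a_i] have gcd 1.  A
    point of [Sgp'] therefore descends to a unique pair [(r_i, t_(d-i))] by
    subtracting [(d, 0)] and [(0, d)] ([Sgp'_decomp]), so these pairs lie in the
    semigroup exactly when it equals [Sgp'], and then they form its Apery set.
    Counting residue classes shows that an Apery set of [d] elements leaves no
    room for exceptional points ([count_no_E_S]).  All these conditions amount to
    the semigroup being [saturated]: a point that enters it along [(0, d)] and
    along [(d, 0)] already belongs to it.

    If there is an exceptional point, there is also a monomial outside the ring
    that the irrelevant maximal ideal multiplies into the ring ([socle_point]).
    That ideal then cannot contain a regular sequence of length two, although it
    has codimension at least two, and the ring is not Cohen-Macaulay
    ([cohen_macaulay_no_E_S]).

    Conversely let the semigroup be saturated.  The ring is noetherian by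
    Hilbert's basis theorem ([mpoly_noetherian]).  A subring of [k[u, v]] has no
    three algebraically independent elements, by a count of monomials
    ([three_dependent]), while a chain of four primes or a regular sequence of
    length three would produce three such elements ([no_three_independent]); so
    depths and codimensions are at most two.  A maximal ideal contains monic
    polynomials [f] in [x_0] and [g] in [x_(n-1)] by a form of the
    Nullstellensatz ([algebraic_mod_maximal]); this is where [k] must be infinite
    for the argument, which evaluates at a point of [k] off the roots of a given
    polynomial.  In [k[u, v]] they become coprime polynomials in [v ^ d] and
    [u ^ d], and saturation makes them a regular sequence in the coordinate ring
    itself ([regular_xy]).  Finally a regular sequence of length two in an ideal
    [P] forces a prime strictly between 0 and [P] ([regular_pair_chain]), so the
    codimension is two as well. *)

(** * Semigroups and Apery sets *)

Lemma uniq_map_inj (T U : eqType) (f : T -> U) (s : seq T) :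
  uniq (map f s) -> {in s &, injective f}.
Proof.
elim: s => // a s IH /= /andP [na us] x y; rewrite !inE.
move=> /predU1P [->|xs] /predU1P [->|ys] // e; last exact: IH.
  by case/negP: na; rewrite e map_f.
by case/negP: na; rewrite -e map_f.
Qed.

Section GeneratedTheory.
Variables (V : zmodType) (n : nat) (g : 'I_n -> V).

Lemma semigroup_gen0 : semigroup_gen g 0.
Proof. by exists (fun=> 0%N); rewrite big1 // => i _; rewrite mulr0n. Qed.

Lemma semigroup_genD x y :
  semigroup_gen g x -> semigroup_gen g y -> semigroup_gen g (x + y).
Proof.
move=> [a ->] [b ->]; exists (fun i => a i + b i)%N.
by rewrite -big_split; apply: eq_bigr => i _; rewrite mulrnDr.
Qed.

Lemma semigroup_gen_gen i : semigroup_gen g (g i).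
Proof.
exists (fun j => (j == i) : nat); rewrite (bigD1 i) //= eqxx big1 ?addr0 // => j.
by move/negPf->.
Qed.

Lemma semigroup_genMn x m : semigroup_gen g x -> semigroup_gen g (x *+ m).
Proof.
move=> Sx; elim: m => [|m IH]; first exact: semigroup_gen0.
by rewrite mulrS; apply: semigroup_genD.
Qed.

End GeneratedTheory.

Lemma eqz_modP (d : nat) (x y : int) :
  (x = y %[mod d%:Z])%Z <-> exists q : int, x = y + q * d%:Z.
Proof.
split=> [/eqP|[q ->]]; last by rewrite addrC modzMDl.
by rewrite eqz_mod_dvd => /dvdzP [q e]; exists q; rewrite -e addrC subrK.
Qed.

Lemma bezout_big_gcdn (F : nat -> nat) m n : exists c : nat -> int,
  \sum_(m <= i < n) (F i)%:Z * c i = (\big[gcdn/0%N]_(m <= i < n) F i)%N%:Z.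
Proof.
elim: n => [|n [c IH]]; first by exists (fun=> 0); rewrite !big_geq.
case: (leqP m n) => [mn|nm]; last by exists (fun=> 0); rewrite !big_geq.
have [u [v e]] := Bezoutz (\big[gcdn/0%N]_(m <= i < n) F i)%N (F n).
exists (fun i => if i == n then v else u * c i).
rewrite !big_nat_recr //= eqxx; move: e; rewrite /gcdz !absz_nat => <-.
rewrite -IH mulr_sumr [v * _]mulrC.
congr (_ + _); rewrite !big_nat; apply: eq_bigr => i /andP [_ i_n].
by rewrite (ltn_eqF i_n) mulrCA.
Qed.

Lemma Apery_descent (S : int -> Prop) (d : nat) :
  (0 < d)%N -> (forall x, S x -> 0 <= x) ->
  forall x, S x -> exists (a : int) (m : nat), Apery S d a /\ x = a + m%:Z * d%:Z.
Proof.
move=> d0 S0 x Sx; have [m] := ubnP `|x|%N; elim: m x Sx => // m IH x Sx xm.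
have [Sxd|nSxd] := classic (S (x - d%:Z)); last first.
  by exists x, 0%N; split=> //; lia.
have [|a [i [Aa e]]] := IH _ Sxd; first by have := S0 _ Sxd; lia.
by exists a, i.+1; split=> //; lia.
Qed.

(** Descent from [x] by multiples of [d] ends at an Apery element of the same
    class, which the enumeration identifies as [r i]. *)
Lemma Apery_enum_descent (S : int -> Prop) (d : nat) (r : nat -> int) :
  (0 < d)%N -> (forall x, S x -> 0 <= x) -> Apery_enum S d r ->
  forall x i, S x -> (i < d)%N -> (x = i%:Z %[mod d%:Z])%Z ->
  exists m : nat, x = r i + m%:Z * d%:Z.
Proof.
move=> d0 S0 [_ rE AE] x i Sx id xi.
have [a [m [/AE [j jd ->] e]]] := Apery_descent d0 S0 Sx.
exists m; rewrite e.
have /eqz_modP [q1 e1] := rE j jd; have /eqz_modP [q2 e2] := xi.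
have {e1 e2 e} : j%:Z = i%:Z + (q2 - q1 - m%:Z) * d%:Z.
  by rewrite !mulrBl; lia.
move: (q2 - q1 - m%:Z) => q jq.
have q0 : q = 0 by nia.
by move: jq; rewrite q0 => jq; congr (r _ + _); lia.
Qed.

(** * Ideals of a commutative ring *)

Section Ideals.
Variable R : comNzRingType.
Implicit Types (I J P : R -> Prop) (s : seq R).

Lemma ideal_opp I x : is_ideal I -> I x -> I (- x).
Proof. by case=> _ _ IM Ix; rewrite -mulN1r; apply: IM. Qed.

Lemma ideal_sub I x y : is_ideal I -> I x -> I y -> I (x - y).
Proof. by move=> idI Ix Iy; case: (idI) => _ ID _; apply: ID => //; apply: ideal_opp. Qed.

Lemma ideal_sum (T : Type) (r : seq T) (p : pred T) (F : T -> R) I :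
  is_ideal I -> (forall i, p i -> I (F i)) -> I (\sum_(i <- r | p i) F i).
Proof. by case=> I0 ID _ IF; apply: big_ind. Qed.

Lemma ideal0_is_ideal : is_ideal (fun x : R => x = 0).
Proof. by split=> // [x y -> ->|a x ->]; rewrite ?addr0 ?mulr0. Qed.

Lemma ideal_gen_ideal s : is_ideal (ideal_gen s).
Proof.
split=> [|x y [c ->] [e ->]|a x [c ->]].
- by exists (fun=> 0); rewrite big1 // => i _; rewrite mul0r.
- exists (fun i => c i + e i); rewrite -big_split; apply: eq_bigr => i _.
  by rewrite mulrDl.
- exists (fun i => a * c i); rewrite mulr_sumr; apply: eq_bigr => i _.
  by rewrite mulrA.
Qed.

Lemma mem_ideal_gen s x : x \in s -> ideal_gen s x.
Proof.
move=> xs; exists (fun i => (i == index x s)%:R).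
have ixs : (index x s < size s)%N by rewrite index_mem.
rewrite (bigD1 (Ordinal ixs)) //= eqxx mul1r nth_index // big1 ?addr0 // => i.
by rewrite -val_eqE /= => /negPf ->; rewrite mul0r.
Qed.

Lemma ideal_gen_min s I :
  is_ideal I -> (forall x, x \in s -> I x) -> forall x, ideal_gen s x -> I x.
Proof.
move=> idI Is x [c ->]; apply: ideal_sum => // i _; case: idI => _ _ IM.
by apply: IM; apply: Is; apply: mem_nth.
Qed.

Lemma ideal_gen1P (f x : R) : ideal_gen [:: f] x <-> exists w, x = f * w.
Proof.
split=> [[c ->]|[w ->]]; first by exists (c 0%N); rewrite big_ord1 mulrC.
by exists (fun=> w); rewrite big_ord1 mulrC.
Qed.

Lemma ideal_gen_nil (x : R) : ideal_gen [::] x <-> x = 0.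
Proof.
split=> [[c ->]|->]; first by rewrite big_ord0.
by case: (ideal_gen_ideal [::]).
Qed.

Lemma ideal_gen_sub s s' x :
  {subset s <= s'} -> ideal_gen s x -> ideal_gen s' x.
Proof.
move=> ss'; apply: ideal_gen_min; first exact: ideal_gen_ideal.
by move=> y /ss'; exact: mem_ideal_gen.
Qed.

Lemma kernel_is_prime (D : idomainType) (f : {rmorphism R -> D}) :
  is_prime (fun x => f x = 0).
Proof.
split; first split=> [|x y fx fy|a x fx].
- exact: rmorph0.
- by rewrite rmorphD fx fy addr0.
- by rewrite rmorphM fx mulr0.
- by rewrite rmorph1; apply/eqP; exact: oner_neq0.
- by move=> x y /eqP; rewrite rmorphM mulf_eq0 => /orP [] /eqP; [left | right].
Qed.

(** Otherwise [P] and [x] would generate a larger proper ideal. *)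
Lemma maximal_inv P x : is_maximal P -> ~ P x -> exists h, P (x * h - 1).
Proof.
move=> [idP nP1 maxP] nPx; apply: NNPP => noinv; apply: nPx.
have [P0 PD PM] := idP.
pose J y := exists h, P (y - x * h).
apply: (maxP J).
- split=> [|y z [h Ph] [l Pl]|a y [h Ph]].
  + by exists 0; rewrite mulr0 subr0.
  + by exists (h + l); rewrite mulrDr opprD addrACA; apply: PD.
  + by exists (a * h); rewrite mulrCA -mulrBr; apply: PM.
- by case=> h Ph; apply: noinv; exists h; rewrite -opprB; apply: ideal_opp.
- by move=> y Py; exists 0; rewrite mulr0 subr0.
- by exists 1; rewrite mulr1 subrr.
Qed.

Lemma maximal_is_prime P : is_maximal P -> is_prime P.
Proof.
move=> maxP; have [idP nP1 _] := maxP; have [P0 PD PM] := idP; split=> // x y Pxy.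
have [Px|nPx] := classic (P x); [by left | right].
have [h Ph] := maximal_inv maxP nPx.
have -> : y = h * (x * y) - y * (x * h - 1) by ring.
by apply: ideal_sub => //; apply: PM.
Qed.

(** The constant term of a relation lies in [J] because [f] does, hence is zero;
    then [f] cancels modulo [I] and the relation gets shorter.  Iterated along a
    chain of ideals this yields algebraic independence, both for chains of
    primes and for regular sequences. *)
Lemma independent_step I J f N (g : nat -> R) :
  is_ideal I -> is_ideal J -> (forall x, I x -> J x) -> J f ->
  (forall y, I (f * y) -> I y) ->
  (forall j, (j < N)%N -> J (g j) -> g j = 0) ->
  I (\sum_(j < N) f ^+ j * g j) -> forall j, (j < N)%N -> g j = 0.
Proof.
move=> idI idJ IJ Jf nzd; have [_ JD JM] := idJ.
elim: N g => [|N IH] g Jg Isum j //.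
have g0 : g 0%N = 0.
  apply: Jg => //; move: (IJ _ Isum); rewrite big_ord_recl expr0 mul1r => Js.
  rewrite -(addrK (\sum_(i < N) f ^+ (lift ord0 i) * g (lift ord0 i)) (g 0%N)).
  apply: ideal_sub => //; apply: ideal_sum => // i _.
  by rewrite exprS -mulrA mulrC; apply: JM.
case: j => [//|j] jN.
apply: (IH (fun j => g j.+1)) => //; first by move=> l lN; exact: Jg.
apply: nzd; move: Isum; rewrite big_ord_recl g0 mulr0 add0r mulr_sumr.
by under eq_bigr do rewrite /= exprS -mulrA.
Qed.

(** Zorn's lemma gives an ideal maximal among those that contain [I] and avoid
    [M].  It is prime: if it contained a product but neither factor, the ideals
    enlarged by the one or the other factor would both meet [M], and the product
    of the two points would be a point of [M] in the ideal itself. *)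
Lemma prime_avoiding I (M : R -> Prop) :
  is_ideal I -> M 1 -> (forall x y, M x -> M y -> M (x * y)) ->
  (forall x, I x -> ~ M x) ->
  exists Q, [/\ is_prime Q, forall x, I x -> Q x & forall x, Q x -> ~ M x].
Proof.
move=> idI M1 MM IM.
pose good J := [/\ is_ideal J, forall x, I x -> J x & forall x, J x -> ~ M x].
pose le (J K : {J | good J}) := boolp.asbool (forall x, sval J x -> sval K x).
have goodI : good I by [].
have [|J K L /boolp.asboolP JK /boolp.asboolP KL|F tot|Q Qmax] :=
    @classical_sets.ZL_preorder _ (exist _ I goodI) le.
- by move=> J; apply/boolp.asboolP.
- by apply/boolp.asboolP => x /JK /KL.
- have [[J0 FJ0]|noF] := classic (exists J : {J | good J}, F J); last first.
    by exists (exist _ I goodI) => J FJ; case: noF; exists J.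
  pose U x := exists2 J : {J | good J}, F J & sval J x.
  have goodU : good U.
    split.
    + split=> [|x y [J FJ Jx] [K FK Ky]|a x [J FJ Jx]].
      * by exists J0 => //; case: (proj2_sig J0) => -[].
      * have [/boolp.asboolP JK|/boolp.asboolP KJ] := tot _ _ FJ FK.
          by exists K => //; case: (proj2_sig K) => -[_ KD _] _ _; apply: KD => //; exact: JK.
        by exists J => //; case: (proj2_sig J) => -[_ JD _] _ _; apply: JD => //; exact: KJ.
      * by exists J => //; case: (proj2_sig J) => -[_ _ JM] _ _; apply: JM.
    + by move=> x Ix; exists J0 => //; case: (proj2_sig J0) => _ IJ _; exact: IJ.
    + by move=> x [J FJ Jx]; case: (proj2_sig J) => _ _ JM; exact: JM.
  exists (exist _ U goodU) => J FJ; apply/boolp.asboolP => x Jx.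
  by exists J.
case: Q Qmax => Q goodQ Qmax; have [idQ IQ QM] := goodQ; exists Q; split=> //.
have [Q0 QD QMul] := idQ.
have meet x : ~ Q x -> exists a q, Q q /\ M (a * x + q).
  move=> nQx; apply: NNPP => noM; apply: nQx.
  pose J y := exists a q, Q q /\ y = a * x + q.
  have goodJ : good J.
    split.
    + split=> [|y z [a [q [Qq ->]]] [b [q' [Qq' ->]]]|b y [a [q [Qq ->]]]].
      * by exists 0, 0; rewrite mul0r addr0.
      * by exists (a + b), (q + q'); rewrite mulrDl addrACA; split=> //; exact: QD.
      * by exists (b * a), (b * q); rewrite mulrDr mulrA; split=> //; exact: QMul.
    + by move=> y Iy; exists 0, y; rewrite mul0r add0r; split=> //; exact: IQ.
    + by move=> y [a [q [Qq ->]]] My; apply/noM; exists a, q.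
  have := Qmax (exist _ J goodJ) => /(_ _)/boolp.asboolP; apply.
    by apply/boolp.asboolP => y Qy; exists 0, y; rewrite mul0r add0r.
  by exists 1, 0; rewrite mul1r addr0.
split=> // [Q1|x y Qxy]; first exact: QM Q1 M1.
apply: NNPP => nQ; have [nQx nQy] : ~ Q x /\ ~ Q y by split=> ?; apply: nQ; [left|right].
have [a [q [Qq Mq]]] := meet x nQx; have [b [q' [Qq' Mq']]] := meet y nQy.
apply: (QM _ _ (MM _ _ Mq Mq')).
have -> : (a * x + q) * (b * y + q') =
   (a * b) * (x * y) + ((b * y + q') * q + (a * x) * q') by ring.
by apply: (QD); [|apply: (QD)]; apply: (QMul).
Qed.

(** A prime that contains [f] and avoids the products of powers of [g] with
    elements outside [P] lies strictly between 0 and [P]; it exists because no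
    such product is a multiple of [f].  This is the inequality between depth and
    codimension in the case of depth two. *)
Lemma regular_pair_chain P f g : is_prime P -> is_prime (fun x : R => x = 0) ->
  P f -> P g -> f <> 0 ->
  (forall y, ideal_gen [:: f] (g * y) -> ideal_gen [:: f] y) ->
  prime_chain P 2.
Proof.
move=> prP pr0 Pf Pg f0 nzd; have [idP nP1 PM] := prP.
pose M x := exists (i : nat) u, ~ P u /\ x = g ^+ i * u.
have [||x y [i [u [Pu ->]]] [j [u' [Pu' ->]]]|x Ix [i [u [Pu E]]]|Q [prQ fQ QM]] :=
    @prime_avoiding (ideal_gen [:: f]) M.
- exact: ideal_gen_ideal.
- by exists 0%N, 1; rewrite mul1r.
- exists (i + j)%N, (u * u'); split; last by rewrite exprD mulrACA.
  by case/PM.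
- apply: Pu; apply: (ideal_gen_min idP (s := [:: f])).
    by move=> z; rewrite inE => /eqP ->.
  move: Ix; rewrite {}E; elim: i => [|i IH]; first by rewrite mul1r.
  by rewrite exprS -mulrA => /nzd.
exists (fun i => match i with 0 => fun x => x = 0 | 1 => Q | _ => P end).
split=> [[|[|i]] //|[|[|i]] // _|//]; split.
- by move=> x ->; case: prQ => -[].
- by exists f; split=> //; apply: fQ; apply: mem_ideal_gen; rewrite inE.
- move=> x Qx; apply: NNPP => nPx; apply: (QM _ Qx).
  by exists 0%N, x; rewrite mul1r.
- exists g; split=> // Qg; apply: (QM _ Qg).
  by exists 1%N, 1; rewrite mulr1.
Qed.

End Ideals.

(** * Algebraic dependence of three polynomials in two variables *)

Section Dependence.
Variable k : fieldType.

(** More vectors than coordinates. *)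
Lemma linear_dependence (T U : finType) (M : T -> U -> k) :
  (#|U| < #|T|)%N ->
  exists c : T -> k, (exists x, c x != 0) /\ forall y, \sum_x c x * M x y = 0.
Proof.
move=> UT; pose B := \matrix_(i < #|T|, j < #|U|) M (enum_val i) (enum_val j).
have : kermx B != 0.
  by rewrite kermx_eq0 /row_free neq_ltn (leq_ltn_trans (rank_leq_col B) UT).
move=> /rowV0Pn [v /sub_kermxP vB /rV0Pn [i vi]].
exists (fun x => v 0 (enum_rank x)); split; first by exists (enum_val i); rewrite enum_valK.
move=> y; transitivity ((v *m B) 0 (enum_rank y)); last by rewrite vB mxE.
rewrite mxE.
rewrite (reindex_onto enum_val enum_rank) /=; last by move=> x _; rewrite enum_rankK.
by apply: eq_big => [j|j _]; rewrite enum_valK ?eqxx // mxE enum_rankK.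
Qed.

Local Notation L := {poly {poly k}}.

Definition bounded_by (D : nat) (z : L) : Prop :=
  forall i j, z`_i`_j != 0 -> (i <= D)%N /\ (j <= D)%N.

Lemma bounded_byW D E z : (D <= E)%N -> bounded_by D z -> bounded_by E z.
Proof. by move=> DE zD i j /zD [iD jD]; split; apply: leq_trans DE. Qed.

Lemma bounded_exists z : exists D, bounded_by D z.
Proof.
exists (maxn (size z) (\max_(i < size z) size (z`_i)%R)) => i j zij.
have iz : (i < size z)%N by rewrite ltnNge; apply: contraNN zij => h; rewrite [z`_i]nth_default // coef0.
have jz : (j < size (z`_i)%R)%N by rewrite ltnNge; apply: contraNN zij => h; rewrite nth_default.
split; first by rewrite leq_max ltnW.
rewrite leq_max; apply/orP; right; apply: leq_trans (ltnW jz) _.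
exact: (leq_bigmax (F := fun i : 'I_(size z) => size (z`_i)%R) (Ordinal iz)).
Qed.

Lemma coef2M (z w : L) i j : (z * w)`_i`_j =
  \sum_(a < i.+1) \sum_(b < j.+1) z`_a`_b * w`_(i - a)`_(j - b).
Proof. by rewrite coefM coef_sum; apply: eq_bigr => a _; rewrite coefM. Qed.

Lemma coef2M_neq0 (z w : L) i j : (z * w)`_i`_j != 0 ->
  exists a b a' b', [/\ z`_a`_b != 0, w`_a'`_b' != 0, i = (a + a')%N & j = (b + b')%N].
Proof.
move=> zw; apply: NNPP => no; case/eqP: zw; rewrite coef2M big1 // => a _.
rewrite big1 // => b _; apply/eqP; apply: contraT; rewrite mulf_eq0 negb_or.
move=> /andP [za wa]; case: no; exists a, b, (i - a)%N, (j - b)%N.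
by split=> //; rewrite subnKC // -ltnS.
Qed.

Lemma bounded_byM D E z w :
  bounded_by D z -> bounded_by E w -> bounded_by (D + E) (z * w).
Proof.
move=> zD wE i j /coef2M_neq0 [a [b [a' [b' [/zD [? ?] /wE [? ?] -> ->]]]]].
by split; apply: leq_add.
Qed.

Lemma bounded_byX D z m : bounded_by D z -> bounded_by (m * D) (z ^+ m).
Proof.
move=> zD; elim: m => [|m IH]; last by rewrite exprS mulSn; exact: bounded_byM.
move=> i j; rewrite expr0 coef1; case: i => [|i]; rewrite ?coef0 ?eqxx //.
by rewrite coef1; case: j => [|j]; rewrite ?eqxx.
Qed.

(** There are [N^3] monomials of exponents below [N] in three elements, but they
    all lie in a space of dimension [O(N^2)]. *)
Lemma three_dependent (f1 f2 f3 : L) : exists N (c : nat -> nat -> nat -> k),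
  (exists i j l, [/\ (i < N)%N, (j < N)%N, (l < N)%N & c i j l != 0]) /\
  \sum_(i < N) f1 ^+ i *
    \sum_(j < N) f2 ^+ j * \sum_(l < N) f3 ^+ l * (c i j l)%:P%:P = 0.
Proof.
have [D1 b1] := bounded_exists f1; have [D2 b2] := bounded_exists f2.
have [D3 b3] := bounded_exists f3; pose D := (D1 + D2 + D3)%N.
(* [N] is chosen so that [(3 N D + 1)^2 < N^3]. *)
pose N := (9 * D.+1 ^ 2).+1; pose E := (3 * (N * D))%N.
pose mon (t : 'I_N * 'I_N * 'I_N) := f1 ^+ t.1.1 * (f2 ^+ t.1.2 * f3 ^+ t.2).
have monE t : bounded_by E (mon t).
  have bX f F (i : 'I_N) : (F <= D)%N -> bounded_by F f -> bounded_by (N * D) (f ^+ i).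
    move=> FD bf; apply: bounded_byW (bounded_byX bf).
    by rewrite leq_mul // ltnW.
  have -> : E = (N * D + (N * D + N * D))%N by rewrite /E; lia.
  apply: bounded_byM; last apply: bounded_byM.
  - by apply: bX b1; rewrite /D; lia.
  - by apply: bX b2; rewrite /D; lia.
  - by apply: bX b3; rewrite /D; lia.
have [|c [[[[i j] l] cn0] cE]] := @linear_dependence ('I_N * 'I_N * 'I_N)%type
   ('I_E.+1 * 'I_E.+1)%type (fun t e => (mon t)`_e.1`_e.2).
  rewrite !card_prod !card_ord.
  have h : (E.+1 <= 3 * N * D.+1)%N by rewrite /E; nia.
  apply: leq_ltn_trans (leq_mul h h) _.
  have -> : (3 * N * D.+1 * (3 * N * D.+1) = N * N * (9 * D.+1 ^ 2))%N by ring.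
  by rewrite ltn_pmul2l // /N; lia.
exists N, (fun i j l => c (inord i, inord j, inord l)); split.
  by exists i, j, l; split; rewrite ?ltn_ord // !inord_val.
transitivity (\sum_t mon t * (c t)%:P%:P).
  transitivity (\sum_(p : 'I_N * 'I_N) \sum_(l' < N) mon (p, l') * (c (p, l'))%:P%:P);
    last by rewrite pair_bigA; apply: eq_bigr => [[p l']].
  transitivity (\sum_(i' < N) \sum_(j' < N) \sum_(l' < N)
      mon (i', j', l') * (c (i', j', l'))%:P%:P);
    last by rewrite pair_bigA; apply: eq_bigr => [[i' j']].
  apply: eq_bigr => i' _; rewrite mulr_sumr; apply: eq_bigr => j' _.
  rewrite mulrA mulr_sumr; apply: eq_bigr => l' _.
  by rewrite !inord_val /mon /= !mulrA.
apply/polyP => a; apply/polyP => b; rewrite !coef0.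
have [[aE bE]|nE] := classic ((a <= E)%N /\ (b <= E)%N); last first.
  rewrite coef_sum coef_sum big1 // => t _; rewrite !coefMC; apply/eqP.
  by rewrite mulf_eq0; apply: contraT; rewrite negb_or => /andP [/monE].
rewrite -[RHS](cE (inord a, inord b)) /= !inordK // coef_sum coef_sum.
by apply: eq_bigr => t _; rewrite !coefMC mulrC.
Qed.

End Dependence.

(** * Dimension and depth of subalgebras of a polynomial ring in two variables *)

Lemma horner_map_poly (A B : comNzRingType) (f : {rmorphism A -> B}) N (F : nat -> A) y :
  (map_poly f (\poly_(i < N) F i)).[y] = \sum_(i < N) f (F i) * y ^+ i.
Proof.
rewrite poly_def rmorph_sum horner_sum; apply: eq_bigr => i _.
by rewrite /= map_polyZ map_polyXn hornerZ hornerXn.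
Qed.

Section Evaluation.
Variables (k : fieldType) (R : comNzRingType) (kappa : {rmorphism k -> R}).

Definition eval1 (x : R) (f : {poly k}) : R := (map_poly kappa f).[x].

HB.instance Definition _ x :=
  GRing.RMorphism.copy (eval1 x) (horner_eval x \o map_poly kappa).

Definition eval2 (x y : R) (G : {poly {poly k}}) : R := (map_poly (eval1 x) G).[y].

HB.instance Definition _ x y :=
  GRing.RMorphism.copy (eval2 x y) (horner_eval y \o map_poly (eval1 x)).

Lemma eval1C x c : eval1 x c%:P = kappa c.
Proof. by rewrite /eval1 map_polyC hornerC. Qed.

Lemma eval1X x : eval1 x 'X = x.
Proof. by rewrite /eval1 map_polyX hornerX. Qed.

Lemma eval1_poly x N (F : nat -> k) :
  eval1 x (\poly_(i < N) F i) = \sum_(i < N) kappa (F i) * x ^+ i.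
Proof. exact: horner_map_poly. Qed.

Lemma eval2_poly x y N (F : nat -> {poly k}) :
  eval2 x y (\poly_(i < N) F i) = \sum_(i < N) eval1 x (F i) * y ^+ i.
Proof. exact: horner_map_poly. Qed.

End Evaluation.

Section PlaneSubalgebra.
Variables (k : fieldType) (R : comNzRingType).
Variables (kappa : {rmorphism k -> R}) (phi : {rmorphism R -> {poly {poly k}}}).
Hypotheses (phi_inj : injective phi) (phi_kappa : forall c, phi (kappa c) = c%:P%:P).

Lemma subalgebra_domain : is_prime (fun x : R => x = 0).
Proof.
have [[K0 KD KM] nK1 Kprime] := kernel_is_prime phi.
have K x : phi x = 0 -> x = 0 by rewrite -(rmorph0 phi) => /phi_inj.
split=> [||x y xy]; [exact: ideal0_is_ideal | by apply/eqP; exact: oner_neq0 |].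
by have [|/K ->|/K ->] := Kprime x y; [rewrite xy rmorph0 | left | right].
Qed.

Lemma scalar_in_proper_ideal (P : R -> Prop) c : is_ideal P -> ~ P 1 -> P (kappa c) -> c = 0.
Proof.
move=> [_ _ PM] nP1 Pc; apply/eqP; apply: contraT => c0; case: nP1.
by rewrite -(rmorph1 kappa) -(mulVf c0) rmorphM; apply: PM.
Qed.

(** The hypotheses make [f1], [f2], [f3] algebraically independent over [k], which
    a subring of [k[u, v]] does not allow.  The ideals are meant to be either four
    primes in a chain, with [f_i] in the [i]-th but not in the one before, or the
    ideals generated by the initial segments of a regular sequence. *)
Lemma no_three_independent (I0 I1 I2 I3 : R -> Prop) f1 f2 f3 :
  [/\ is_ideal I0, is_ideal I1, is_ideal I2 & is_ideal I3] -> ~ I3 1 ->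
  [/\ forall x, I0 x -> I1 x, forall x, I1 x -> I2 x & forall x, I2 x -> I3 x] ->
  [/\ I1 f1, I2 f2 & I3 f3] ->
  [/\ forall y, I0 (f1 * y) -> I0 y, forall y, I1 (f2 * y) -> I1 y &
      forall y, I2 (f3 * y) -> I2 y] -> False.
Proof.
move=> [id0 id1 id2 id3] nI1 [I01 I12 I23] [If1 If2 If3] [nz1 nz2 nz3].
have [N [c [[i [j [l [iN jN lN cn0]]]] cE]]] :=
  three_dependent (phi f1) (phi f2) (phi f3).
pose h3 a b := \sum_(e < N) f3 ^+ e * kappa (c a b e).
pose h2 a := \sum_(b < N) f2 ^+ b * h3 a b.
have h1 : \sum_(a < N) f1 ^+ a * h2 a = 0.
  apply: phi_inj; rewrite rmorph0 -cE rmorph_sum; apply: eq_bigr => a _.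
  rewrite rmorphM rmorphXn; congr (_ * _); rewrite rmorph_sum.
  apply: eq_bigr => b _; rewrite rmorphM rmorphXn; congr (_ * _).
  rewrite rmorph_sum; apply: eq_bigr => e _.
  by rewrite rmorphM rmorphXn /= phi_kappa.
have z3 a b : I2 (h3 a b) -> forall e, (e < N)%N -> c a b e = 0.
  move=> I2h e eN; have := independent_step (g := fun e => kappa (c a b e)) id2 id3 I23 If3 nz3 _ I2h eN.
  move=> ke; apply: (scalar_in_proper_ideal id3 nI1); rewrite ke; first by case: id3.
  by move=> e' _ I3e; rewrite (scalar_in_proper_ideal id3 nI1 I3e) rmorph0.
have z3' a b : I2 (h3 a b) -> h3 a b = 0.
  by move=> I2h; apply: big1 => e _; rewrite z3 // rmorph0 mulr0.
have z2 a : I1 (h2 a) -> forall b, (b < N)%N -> h3 a b = 0.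
  by move=> I1h; apply: (independent_step (g := h3 a) id1 id2 I12 If2 nz2 _ I1h) => b _; exact: z3'.
have z2' a : I1 (h2 a) -> h2 a = 0.
  by move=> I1h; apply: big1 => b _; rewrite z2 // mulr0.
have z1 a : (a < N)%N -> h2 a = 0.
  move: a; apply: (independent_step (g := h2) id0 id1 I01 If1 nz1); first by move=> a _; exact: z2'.
  by rewrite h1; case: id0.
have I0z (I : R -> Prop) : is_ideal I -> I 0 by case.
move/eqP: cn0; apply; apply: z3 => //; rewrite z2 //; first exact: I0z.
by rewrite z1 //; exact: I0z.
Qed.

Lemma codim_le2 (P : R -> Prop) r : prime_chain P r -> (r <= 2)%N.
Proof.
move=> [Q [prQ ltQ _]]; rewrite leqNgt; apply/negP => r3.
have lt i : (i < 3)%N -> ideal_lt (Q i) (Q i.+1) by move=> i3; apply: ltQ; lia.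
have [s01 [f1 [Q1f1 nQ0f1]]] := lt 0%N isT.
have [s12 [f2 [Q2f2 nQ1f2]]] := lt 1%N isT.
have [s23 [f3 [Q3f3 nQ2f3]]] := lt 2%N isT.
have prQ' i : (i <= 3)%N -> is_prime (Q i) by move=> i3; apply: prQ; lia.
have nz i f : (i <= 3)%N -> ~ Q i f -> forall y, Q i (f * y) -> Q i y.
  by move=> i3 nQf y; case: (prQ' i i3) => _ _ QM /QM [].
have idQ i : (i <= 3)%N -> is_ideal (Q i) by move/prQ' => [].
apply: (@no_three_independent (Q 0%N) (Q 1%N) (Q 2%N) (Q 3) f1 f2 f3) => //.
- by split; apply: idQ.
- by case: (prQ' 3).
- by split; apply: nz.
Qed.

Lemma depth_le2 (s : seq R) : regular_seq s -> (size s <= 2)%N.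
Proof.
case: s => [|f1 [|f2 [|f3 s]]] // [n1 reg]; exfalso.
have sub (s1 s2 : seq R) : {subset s1 <= s2} -> forall x, ideal_gen s1 x -> ideal_gen s2 x.
  by move=> ss x; exact: ideal_gen_sub.
apply: (@no_three_independent (ideal_gen [::]) (ideal_gen [:: f1])
  (ideal_gen [:: f1; f2]) (ideal_gen [:: f1; f2; f3]) f1 f2 f3).
- by split; exact: ideal_gen_ideal.
- by move/sub => /(_ (f1 :: f2 :: f3 :: s)) h; apply: n1; apply: h => x; rewrite !inE => /or3P [] /eqP ->; rewrite eqxx ?orbT.
- by split; apply: sub => x; rewrite !inE // => h; rewrite ?h ?orbT // orbA h.
- by split; apply: mem_ideal_gen; rewrite !inE eqxx ?orbT.
- split=> y.
  + exact: (reg 0%N).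
  + exact: (reg 1%N).
  + exact: (reg 2%N).
Qed.

(** Together with a nonzero element of [P], two elements independent modulo [P]
    would again be three independent ones. *)
Lemma two_dependent (P : R -> Prop) f x y : is_prime P -> P f -> f <> 0 ->
  exists G : {poly {poly k}}, G != 0 /\ P (eval2 kappa x y G).
Proof.
move=> prP Pf f0; have [idP nP1 _] := prP.
have [N [c [[i [j [l [iN jN lN cn0]]]] cE]]] :=
  three_dependent (phi f) (phi x) (phi y).
pose h a := \sum_(b < N) x ^+ b * \sum_(e < N) y ^+ e * kappa (c a b e).
have h1 : \sum_(a < N) f ^+ a * h a = 0.
  apply: phi_inj; rewrite rmorph0 -cE rmorph_sum; apply: eq_bigr => a _.
  rewrite rmorphM rmorphXn; congr (_ * _); rewrite rmorph_sum.
  apply: eq_bigr => b _; rewrite rmorphM rmorphXn; congr (_ * _).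
  rewrite rmorph_sum; apply: eq_bigr => e _.
  by rewrite rmorphM rmorphXn /= phi_kappa.
pose G a : {poly {poly k}} := \poly_(e < N) \poly_(b < N) c a b e.
have GE a : h a = eval2 kappa x y (G a).
  rewrite eval2_poly /h.
  under [LHS]eq_bigr do rewrite mulr_sumr.
  rewrite exchange_big; apply: eq_bigr => e _.
  rewrite eval1_poly mulr_suml; apply: eq_bigr => b _.
  by rewrite mulrCA [RHS]mulrC [kappa _ * _]mulrC.
apply: NNPP => no.
have Gz a : P (h a) -> G a = 0.
  by move=> Pa; apply/eqP; apply: contraT => Ga; case: no; exists (G a); rewrite -GE.
have hz a : P (h a) -> h a = 0.
  by move=> Pa; rewrite GE Gz // rmorph0.
have hz' : forall a, (a < N)%N -> h a = 0.
  apply: (independent_step (g := h) (ideal0_is_ideal R) idP _ Pf).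
  - by move=> z ->; case: idP.
  - move=> z /(congr1 phi) /eqP; rewrite rmorphM rmorph0 mulf_eq0 => /orP [] /eqP.
      by rewrite -(rmorph0 phi) => /phi_inj.
    by rewrite -(rmorph0 phi) => /phi_inj.
  - by move=> a _; exact: hz.
  - exact: h1.
move/eqP: cn0; apply; have P0 : P 0 by case: idP.
have := Gz i; rewrite hz' // => /(_ P0) /(congr1 (fun g : {poly {poly k}} => g`_l`_j)).
by rewrite !coef_poly lN coef_poly jN !coef0.
Qed.

End PlaneSubalgebra.

(** * Maximal ideals and algebraic elements *)

Lemma infinite_nonroot (k : fieldType) (p : {poly k}) :
  infinite_type k -> p != 0 -> exists a, p.[a] != 0.
Proof.
move=> kinf p0; apply: NNPP => no.
have [s [us ss]] : exists s : seq k, uniq s /\ size s = size p.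
  elim: (size p) => [|m [s [us <-]]]; first by exists [::].
  by have [a sa] := kinf s; exists (a :: s); rewrite /= sa us.
have roots_s : all (root p) s.
  by apply/allP => a _; apply: contraT => pa; case: no; exists a.
by have := max_poly_roots p0 roots_s us; rewrite ss ltnn.
Qed.

Section Zariski.
Variables (k : fieldType) (R : comNzRingType) (kappa : {rmorphism k -> R}).
Variables (P : R -> Prop) (x y : R) (T : finType) (w : T -> R).
Hypotheses (kinf : infinite_type k) (maxP : is_maximal P).
(* The [w t] span [R] as a module over [k[x, y]], put as an induction principle
   so that no double sums of coefficients have to be written. *)
Hypothesis spanning : forall E : R -> Prop,
  (forall a b, E a -> E b -> E (a + b)) ->
  (forall c i j t, E (kappa c * x ^+ i * y ^+ j * w t)) -> forall a, E a.

Local Notation ev := (eval1 kappa x).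

(** Cramer's rule, modulo an ideal. *)
Lemma det_annihilates n (B : 'M[R]_n) (u : 'I_n -> R) :
  (forall i, P (\sum_j B i j * u j)) -> forall j, P (\det B * u j).
Proof.
have [idP _ _] := maxP; have [_ _ PM] := idP; move=> PB j.
pose v : 'cV[R]_n := \col_i u i.
have -> : \det B * u j = (\adj B *m (B *m v)) j 0.
  by rewrite mulmxA mul_adj_mx mul_scalar_mx !mxE.
rewrite mxE; apply: ideal_sum => // i _; apply: PM; rewrite mxE.
by have := PB i; congr P; apply: eq_bigr => l _; rewrite [v l 0]mxE.
Qed.

(** The Nullstellensatz in the case needed.  Suppose that no nonzero polynomial
    in [x] lies in [P], and let [c] be the leading coefficient of [G] in [y].
    Modulo [P] the ring is then a finite module over [k[x, 1/c]], hence the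
    inverse of [x - a] is integral over [k[x, 1/c]] for each [a].  Cleared of
    denominators, the determinant of this integral relation is a polynomial in
    [x] that lies in [P], so it is zero; but its value at [a] is a power of
    [c(a)], which is not zero for a suitable [a] since [k] is infinite. *)
Lemma algebraic_mod_maximal (G : {poly {poly k}}) :
  G != 0 -> P (eval2 kappa x y G) -> exists f, f != 0 /\ P (ev f).
Proof.
move=> G0 PG; have [idP nP1 _] := maxP; have [P0 PD PM] := idP.
have [_ _ Pprime] := maximal_is_prime maxP.
apply: NNPP => no.
have noP f : P (ev f) -> f = 0.
  by move=> Pf; apply/eqP; apply: contraT => f0; case: no; exists f.
pose e := (size G).-1; pose c := lead_coef G.
have c0 : c != 0 by rewrite lead_coef_eq0.
have [a ca] := infinite_nonroot kinf c0.
pose W (u : T * 'I_e.+1) := w u.1 * y ^+ u.2.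
(* [D N r]: after multiplication by [c ^ N], [r] is modulo [P] a combination of
   the [W u] with coefficients in [k[x]]. *)
pose D N r := exists b : T * 'I_e.+1 -> {poly k},
  P (ev (c ^+ N) * r - \sum_u ev (b u) * W u).
have Dle N M r : (N <= M)%N -> D N r -> D M r.
  move=> NM [b Pb]; exists (fun u => c ^+ (M - N) * b u).
  have -> : \sum_u ev (c ^+ (M - N) * b u) * W u
     = ev (c ^+ (M - N)) * \sum_u ev (b u) * W u.
    by rewrite mulr_sumr; apply: eq_bigr => u _; rewrite rmorphM mulrA.
  rewrite -[in c ^+ M](subnK NM) exprD rmorphM -mulrA -mulrBr; exact: PM.
have DD N r s : D N r -> D N s -> D N (r + s).
  move=> [b Pb] [b' Pb']; exists (fun u => b u + b' u).
  have -> : \sum_u ev (b u + b' u) * W u =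
      \sum_u ev (b u) * W u + \sum_u ev (b' u) * W u.
    by rewrite -big_split; apply: eq_bigr => u _; rewrite rmorphD mulrDl.
  by rewrite mulrDr opprD addrACA; apply: PD.
have DZ N p r : D N r -> D N (ev p * r).
  move=> [b Pb]; exists (fun u => p * b u).
  have -> : \sum_u ev (p * b u) * W u = ev p * \sum_u ev (b u) * W u.
    by rewrite mulr_sumr; apply: eq_bigr => u _; rewrite rmorphM mulrA.
  by rewrite mulrCA -mulrBr; apply: PM.
have Dc N r : D N (ev c * r) -> D N.+1 r.
  by move=> [b Pb]; exists b; rewrite exprSr rmorphM -mulrA.
have DP N r s : P (r - s) -> D N s -> D N r.
  move=> Prs [b Pb]; exists b.
  have -> : ev (c ^+ N) * r - \sum_u ev (b u) * W u =
    ev (c ^+ N) * (r - s) + (ev (c ^+ N) * s - \sum_u ev (b u) * W u) by ring.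
  by apply: PD => //; apply: PM.
have D0 N : D N 0.
  exists (fun=> 0); rewrite big1 ?mulr0 ?subrr // => u _.
  by rewrite rmorph0 mul0r.
have DW N t (j : nat) : (j <= e)%N -> D N (w t * y ^+ j).
  move=> je; exists (fun u => if u == (t, inord j) then c ^+ N else 0).
  rewrite (bigD1 (t, inord j)) //= eqxx big1 ?addr0 => [|u /negPf ->].
    by rewrite /W /= inordK // subrr.
  by rewrite rmorph0 mul0r.
(* [c y ^ e] is a combination of lower powers of [y], by the relation [G]. *)
have Dy t j : exists N, D N (w t * y ^+ j).
  have [m] := ubnP j; elim: m j => // m IH j jm.
  have [je|ej] := leqP j e; first by exists 0%N; apply: DW.
  have [N DN] : exists N, forall l : 'I_e, D N (w t * y ^+ (j - e + l)).
    have /fin_all_exists [N DN] : forall l : 'I_e, exists N,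
        D N (w t * y ^+ (j - e + l)).
      by move=> l; apply: IH; have := ltn_ord l; lia.
    exists (\max_l N l) => l; apply: Dle (DN l).
    exact: (leq_bigmax (F := N)).
  exists N.+1; apply: Dc.
  apply: (DP _ _ (- \sum_(l < e) ev G`_l * (w t * y ^+ (j - e + l)))).
    have -> : ev c * (w t * y ^+ j) - - (\sum_(l < e) ev G`_l * (w t * y ^+ (j - e + l)))
       = w t * y ^+ (j - e) * eval2 kappa x y G.
      rewrite opprK -[in RHS](coefK G) eval2_poly -(prednK (_ : 0 < size G)%N); last first.
        by rewrite size_poly_gt0.
      rewrite -/e big_ord_recr /= mulrDr addrC mulr_sumr; congr (_ + _).
        by apply: eq_bigr => l _; rewrite exprD; ring.
      by rewrite -[in LHS](subnK (ltnW ej)) exprD -/(ev c); ring.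
    exact: PM.
  rewrite -mulN1r -(rmorphN1 ev); apply: (DZ).
  by apply: big_ind => [||l _]; [exact: D0 | exact: DD | exact: DZ].
have Dall r : exists N, D N r.
  move: r; apply: (spanning (E := fun r => exists N, D N r)) => [r1 r2 [N1 D1] [N2 D2]|s i j t].
    exists (maxn N1 N2); apply: DD; [apply: Dle D1|apply: Dle D2];
      by rewrite ?leq_maxl ?leq_maxr.
  have [N DN] := Dy t j; exists N.
  have -> : kappa s * x ^+ i * y ^+ j * w t = ev (s%:P * 'X^i) * (w t * y ^+ j).
    by rewrite rmorphM rmorphXn /= -/(ev s%:P) -/(ev 'X) eval1C eval1X; ring.
  exact: DZ.
(* [h] is the inverse of [x - a]; clearing it from its matrix equation with
   denominators [c ^ N] leaves the matrix [B] that annihilates the [W u]. *)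
have xa : ~ P (ev ('X - a%:P)) by move/noP/eqP; rewrite polyXsubC_eq0.
have [h Ph] := maximal_inv maxP xa.
have [N DN] : exists N, forall u, D N (h * W u).
  have /fin_all_exists [N DN] : forall u, exists N, D N (h * W u) by move=> u.
  exists (\max_u N u) => u; apply: Dle (DN u).
  exact: (leq_bigmax (F := N)).
have /fin_all_exists [b Pb] := DN.
pose U := (T * 'I_e.+1)%type.
pose B : 'M[{poly k}]_#|{: U}| :=
  \matrix_(i, j) ((c ^+ N) *+ (i == j) - ('X - a%:P) * b (enum_val i) (enum_val j)).
have PB u : P (ev (\det B) * W u).
  rewrite -det_map_mx -[u]enum_rankK.
  apply: (det_annihilates (u := fun j => W (enum_val j))) => i.
  pose xi := ev ('X - a%:P); pose v := enum_val i.
  have -> : \sum_j (map_mx ev B) i j * W (enum_val j)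
      = ev (c ^+ N) * W v - xi * \sum_u' ev (b v u') * W u'.
    have -> : \sum_u' ev (b v u') * W u'
        = \sum_(j < #|{: U}|) ev (b v (enum_val j)) * W (enum_val j).
      rewrite (reindex_onto enum_val enum_rank) => [|u' _]; last exact: enum_rankK.
      by apply: eq_bigl => j; rewrite enum_valK eqxx.
    rewrite mulr_sumr.
    have -> : ev (c ^+ N) * W v = \sum_j (ev (c ^+ N) *+ (i == j)) * W (enum_val j).
      rewrite (bigD1 i) //= eqxx mulr1n big1 ?addr0 // => j.
      by rewrite eq_sym => /negPf ->; rewrite mulr0n mul0r.
    rewrite -sumrB; apply: eq_bigr => j _.
    by rewrite !mxE rmorphB rmorphMn rmorphM mulrBl -mulrA.
  have -> : ev (c ^+ N) * W v - xi * \sum_u' ev (b v u') * W u'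
      = xi * (ev (c ^+ N) * (h * W v) - \sum_u' ev (b v u') * W u')
        - ev (c ^+ N) * W v * (xi * h - 1) by ring.
  by apply: ideal_sub => //; apply: PM => //; exact: Pb.
have B0 : \det B = 0.
  have [M [b1 Pb1]] := Dall 1.
  have : P (ev (c ^+ M * \det B)).
    have -> : ev (c ^+ M * \det B) =
        ev (\det B) * (ev (c ^+ M) * 1 - \sum_u ev (b1 u) * W u)
        + \sum_u ev (b1 u) * (ev (\det B) * W u).
      rewrite rmorphM mulrBr mulr1 [_ * ev (\det B)]mulrC mulr_sumr.
      by under [X in _ = _ + X]eq_bigr do rewrite mulrCA; rewrite subrK.
    by apply: PD; [exact: PM | apply: ideal_sum => // u _; exact: PM].
  by move/noP/eqP; rewrite mulf_eq0 expf_eq0 (negPf c0) andbF => /eqP.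
have : (\det B).[a] = c.[a] ^+ (N * #|{: U}|).
  rewrite -[LHS]/(horner_eval a (\det B)) -det_map_mx exprM -det_scalar.
  congr (\det _); apply/matrixP => i j; rewrite !mxE /= /horner_eval.
  by rewrite hornerD hornerN hornerM hornerXsubC subrr mul0r subr0 hornerMn horner_exp.
by rewrite B0 horner0 => /esym/eqP; rewrite expf_eq0 (negPf ca) andbF.
Qed.

End Zariski.

(** * Hilbert's basis theorem *)

(** Dickson's lemma.  The tails of all members of [U] have a finite basis, which
    serves for every head above the finitely many heads [a] it comes with; each
    of the remaining heads is dealt with on its own. *)
Lemma dickson n (U : seq nat -> Prop) :
  exists ms : seq (seq nat), (forall m, m \in ms -> U m) /\
    forall m, U m -> size m = n -> exists2 m', m' \in ms & all2 leq m' m.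
Proof.
elim: n U => [|n IH] U.
  have [U0|nU0] := classic (U [::]); last by exists [::]; split=> // -[].
  exists [:: [::]]; split=> [m|[] // _ _]; first by rewrite inE => /eqP ->.
  by exists [::]; rewrite ?inE.
have [ts [tsU tsB]] := IH (fun s => exists a, U (a :: s)).
have [a [ms [msU msB]]] : exists (a : nat) (ms : seq (seq nat)), (forall m, m \in ms -> U m) /\
    forall s, s \in ts -> exists2 b, (b <= a)%N & b :: s \in ms.
  elim: ts tsU {tsB} => [|s ts IHs] tsU; first by exists 0%N, [::].
  have [|a [ms [msU msB]]] := IHs; first by move=> s' s'ts; exact: tsU (mem_behead (s := s :: ts) s'ts).
  have [b Ub] := tsU s (mem_head _ _).
  exists (maxn a b), ((b :: s) :: ms); split=> [m|s'].
    by rewrite inE => /predU1P [->|/msU].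
  rewrite inE => /predU1P [->|/msB [b' b'a b'm]].
    by exists b; rewrite ?leq_maxr // mem_head.
  by exists b'; rewrite ?leq_max ?b'a // inE b'm orbT.
have [ms' [ms'U ms'B]] : exists ms' : seq (seq nat), (forall m, m \in ms' -> U m) /\
    forall b s, (b < a)%N -> U (b :: s) -> size s = n ->
      exists2 m', m' \in ms' & all2 leq m' (b :: s).
  elim: (a) => [|c [ms' [ms'U ms'B]]]; first by exists [::].
  have [us [usU usB]] := IH (fun s => U (c :: s)).
  exists ([seq c :: s | s <- us] ++ ms'); split=> [m|b s].
    by rewrite mem_cat => /orP [/mapP [s su ->]|/ms'U //]; exact: usU.
  rewrite ltnS leq_eqVlt => /predU1P [->|bc] Ub sn.
    have [s' s'u ss'] := usB s Ub sn.
    by exists (c :: s'); rewrite ?mem_cat ?map_f //= leqnn.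
  by have [m' m'm le] := ms'B b s bc Ub sn; exists m'; rewrite // mem_cat m'm orbT.
exists (ms ++ ms'); split=> [m|[//|b s] Ub [sn]].
  by rewrite mem_cat => /orP [/msU|/ms'U].
have [ba|ab] := ltnP b a.
  by have [m' m'm le] := ms'B b s ba Ub sn; exists m'; rewrite // mem_cat m'm orbT.
have [s' s't le] := tsB s (ex_intro _ b Ub) sn.
have [b' b'a b'm] := msB s' s't; exists (b' :: s'); first by rewrite mem_cat b'm.
by rewrite /= le (leq_trans b'a ab).
Qed.

Lemma noetherian_surj (R S : comNzRingType) (f : {rmorphism R -> S}) :
  (forall y, exists x, f x = y) -> noetherian R -> noetherian S.
Proof.
move=> fs nR I [I0 ID IM].
have [|s sI] := nR (fun x => I (f x)).
  by split=> [|x y Ix Iy|a x Ix]; rewrite ?rmorph0 ?rmorphD ?rmorphM //; auto.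
have idI : is_ideal I by [].
exists [seq f x | x <- s] => y; split.
  have [x <-] := fs y => /sI [c ->].
  have [c' fc'] : exists c' : nat -> S, forall i, c' i = f (c i) by exists (f \o c).
  exists c'; rewrite size_map rmorph_sum; apply: eq_bigr => i _.
  by rewrite rmorphM fc' (nth_map 0).
apply: ideal_gen_min => // z /mapP [x xs ->]; apply/sI; exact: mem_ideal_gen.
Qed.

(** Hilbert's basis theorem: elements whose leading monomials generate, by
    Dickson's lemma, all leading monomials of the ideal generate the ideal,
    because dividing by them lowers the leading monomial. *)
Lemma mpoly_noetherian (k : fieldType) n : noetherian {mpoly k[n]}.
Proof.
move=> I idI; have [I0 ID IM] := idI.
pose U (l : seq nat) := exists f : {mpoly k[n]}, [/\ I f, f != 0 & l = mlead f].
have [ms [msU msB]] := dickson n U.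
have [fs [fsI fsB]] : exists fs : seq {mpoly k[n]}, (forall f, f \in fs -> I f) /\
    forall l, l \in ms -> exists f, [/\ f \in fs, f != 0 & l = mlead f].
  elim: ms msU {msB} => [|l ms IH] msU; first by exists [::].
  have [|fs [fsI fsB]] := IH; first by move=> m mms; exact: msU (mem_behead (s := l :: ms) mms).
  have [f [If f0 lf]] := msU l (mem_head _ _).
  exists (f :: fs); split=> [g|m].
    by rewrite inE => /predU1P [->|/fsI].
  rewrite inE => /predU1P [->|/fsB [g [gfs g0 mg]]]; first by exists f; rewrite mem_head.
  by exists g; rewrite inE gfs orbT.
exists fs => g; split; last exact: ideal_gen_min.
have [_ GD GM] := ideal_gen_ideal fs.
have [m] : exists m, m = mlead g by exists (mlead g).
elim/(well_founded_ind (@ltom_wf n)): m g => m IH g mg Ig.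
have [->|g0] := eqVneq g 0; first by case: (ideal_gen_ideal fs).
have [|l lms lg] := msB (mlead g) (ex_intro _ g (And3 Ig g0 erefl)).
  by rewrite size_tuple.
have [f [ffs f0 lf]] := fsB l lms; subst l.
have le : (mlead f <= mlead g)%MM.
  apply/mnm_lepP => i; rewrite !(mnm_nth 0%N).
  move: lg; rewrite all2E => /andP [/eqP sz /(all_nthP (0%N, 0%N)) /(_ i)].
  by rewrite size_zip nth_zip // !size_tuple minnn => /(_ (ltn_ord i)).
have c0 : mleadc g / mleadc f != 0.
  by rewrite mulf_neq0 ?invr_eq0 ?mleadc_eq0.
pose q : {mpoly k[n]} := (mleadc g / mleadc f) *: 'X_[mlead g - mlead f].
have Gqf : ideal_gen fs (q * f) by apply: GM; exact: mem_ideal_gen.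
rewrite -(subrK (q * f) g); apply: GD => //.
have [->|h0] := eqVneq (g - q * f) 0; first by case: (ideal_gen_ideal fs).
apply: (IH (mlead (g - q * f))) => //; last first.
  by apply: ideal_sub => //; apply: IM; exact: fsI.
have lq0 : mlead q = (mlead g - mlead f)%MM by rewrite mleadZ_proper ?mleadXm ?mcoeffX ?eqxx ?mulr1.
have cq0 : mleadc q = mleadc g / mleadc f by rewrite lq0 mcoeffZ mcoeffX eqxx mulr1.
have qf0 : mleadc q * mleadc f != 0 by rewrite cq0 mulf_neq0 // mleadc_eq0.
have lq : mlead (q * f) = mlead g.
  by rewrite -[RHS](submK le) -lq0; exact: mleadM_proper qf0.
have cq : (q * f)@_(mlead g) = mleadc g.
  have := mleadcM_proper qf0; rewrite cq0 divfK ?mleadc_eq0 // => <-.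
  by rewrite -lq.
rewrite mg lt_neqAle; apply/andP; split.
  by apply: contraNneq h0 => e; rewrite -mleadc_eq0 e mcoeffB cq subrr.
by have := mleadB_le g (q * f); rewrite lq joinxx.
Qed.

(** * The polynomial ring in two variables *)

Section Plane.
Variable k : fieldType.
Local Notation L := {poly {poly k}}.

(** [u ^ i * v ^ j], with [u] the outer and [v] the inner variable. *)
Definition plane_mon (i j : nat) : L := ('X^j)%:P * 'X^i.

Lemma coef_plane_mon i j a b : (plane_mon i j)`_a`_b = ((a == i) && (b == j))%:R.
Proof.
rewrite coefCM coefXn; case: eqP => _ /=; last by rewrite mulr0 coef0.
by rewrite mulr1 coefXn.
Qed.

Lemma plane_monM i j i' j' :
  plane_mon i j * plane_mon i' j' = plane_mon (i + i') (j + j').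
Proof. by rewrite /plane_mon mulrACA -polyCM -!exprD. Qed.

Lemma plane_monX i j m : plane_mon i j ^+ m = plane_mon (i * m) (j * m).
Proof. by rewrite /plane_mon exprMn -rmorphXn -!exprM. Qed.

Lemma plane_mon_prod (I : finType) (f g : I -> nat) :
  \prod_i plane_mon (f i) (g i) = plane_mon (\sum_i f i) (\sum_i g i).
Proof.
by rewrite /plane_mon big_split /= -rmorph_prod /= !prodrXr.
Qed.

Definition const2 : {rmorphism k -> L} := polyC \o polyC.

Definition to_plane : {rmorphism {mpoly k[2]} -> L} :=
  mmap const2 (fun i : 'I_2 => if i == ord0 then 'X else 'X%:P).

Lemma to_planeX (m : 'X_{1..2}) : to_plane 'X_[m] = plane_mon (m ord0) (m ord_max).
Proof.
rewrite /to_plane /= mmapX /mmap1 big_ord_recl big_ord1 /=.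
have -> : lift ord0 ord0 = ord_max :> 'I_2 by apply/val_inj.
by rewrite mulrC /plane_mon rmorphXn.
Qed.

Lemma to_planeE p :
  to_plane p = \sum_(m <- msupp p) const2 p@_m * plane_mon (m ord0) (m ord_max).
Proof.
rewrite {1}[p]mpolyE rmorph_sum; apply: eq_bigr => m _.
by rewrite -mul_mpolyC rmorphM to_planeX /to_plane /= mmapC.
Qed.

Lemma to_plane_inj : injective to_plane.
Proof.
apply: raddf_inj => p p0; apply/eqP; rewrite -msupp_eq0; apply/eqP.
case E : (msupp p) => [//|m s]; exfalso.
have mp : m \in msupp p by rewrite E mem_head.
move: (mp); rewrite mcoeff_msupp => /eqP; apply.
have := congr1 (fun z : L => z`_(m ord0)`_(m ord_max)) (p0 : to_plane p = 0).
rewrite /= to_planeE !coef0 coef_sum coef_sum (bigD1_seq m) ?msupp_uniq //=.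
rewrite coefCM coefCM coef_plane_mon !eqxx mulr1 big1 ?addr0 // => m' m'm.
rewrite coefCM coefCM coef_plane_mon; case: andP => [[/eqP e0 /eqP e1]|]; last by rewrite mulr0.
case/eqP: m'm; apply/mnmP => i; case: (unliftP ord0 i) => [j ->|->] //.
by rewrite (_ : lift ord0 j = ord_max) //; apply/val_inj; rewrite /= (ord1 j).
Qed.

End Plane.

(** Division by the monic [G] leaves a remainder [r] with [c r] divisible by
    [G] but of smaller size, hence zero. *)
Lemma monic_coprime_const (D : idomainType) (G z w : {poly D}) (c : D) :
  G \is monic -> c != 0 -> c%:P * z = G * w -> exists q, z = G * q /\ w = c%:P * q.
Proof.
move=> Gm c0 E; pose q := Pdiv.Ring.rdivp z G; pose r := Pdiv.Ring.rmodp z G.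
have zE : z = G * q + r by rewrite mulrC; exact: Pdiv.RingMonic.rdivp_eq.
have rE : c%:P * r = G * (w - c%:P * q) by rewrite mulrBr -E zE; ring.
have G0 := monic_neq0 Gm.
have wq : w - c%:P * q = 0.
  apply/eqP; apply: contraT => h0; have := Pdiv.Ring.ltn_rmodpN0 z G0.
  rewrite -/r ltnNge; case/negP; apply: leq_trans (size_scale_leq c r).
  rewrite -mul_polyC rE size_mul //.
  by rewrite -subn1 -addnBA ?leq_addr // size_poly_gt0.
have r0 : r = 0.
  by move/eqP: rE; rewrite wq mulr0 mulf_eq0 polyC_eq0 (negPf c0) => /eqP.
by exists q; rewrite zE r0 addr0; split=> //; apply/eqP; rewrite -subr_eq0 wq.
Qed.

(** The lowest term of [f] moves each monomial of [h] into [T]; a monomial of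
    [h] for which it did not would be cancelled by one of lower degree in the
    same class, from which the statement is known. *)
Lemma lowest_term_shift (k : fieldType) (f h : {poly k}) d (T : nat -> Prop) :
  (0 < d)%N -> f != 0 -> (forall j, T j -> T (j + d)%N) ->
  (forall j, ((f \Po 'X^d) * h)`_j != 0 -> T j) ->
  exists e, forall j, h`_j != 0 -> T (j + e * d)%N.
Proof.
move=> d0 f0 Td TF.
have Tm m j : T j -> T (j + m * d)%N.
  by elim: m => [|m IH] Tj; rewrite ?addn0 // mulSn addnCA addnC; apply/Td/IH.
have [e fe emin] : exists2 e, f`_e != 0 & forall i, (i < e)%N -> f`_i = 0.
  have ex : exists i, f`_i != 0 by exists (size f).-1; rewrite -lead_coefE lead_coef_eq0.
  case: (ex_minnP ex) => e fe emin; exists e => // i ie.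
  by apply/eqP; apply: contraT => /emin; rewrite leqNgt ie.
exists e => j; have [m] := ubnP j; elim: m j => // m IH j jm hj.
apply: NNPP => nT.
have : ((f \Po 'X^d) * h)`_(j + e * d) = f`_e * h`_j.
  have lt : (e * d < (j + e * d).+1)%N by rewrite ltnS leq_addl.
  rewrite coefM (bigD1 (Ordinal lt)) //= coef_comp_poly_Xn // dvdn_mull // mulnK // addnK.
  rewrite big1 ?addr0 // => -[l lj] /= lne; rewrite coef_comp_poly_Xn //.
  case: ifP => [/dvdnP [i li]|_]; last by rewrite mul0r.
  rewrite li mulnK //; have [ie|ei|ei] := ltngtP i e; first by rewrite emin ?mul0r.
    have [->|hn] := eqVneq h`_(j + e * d - i * d) 0; first by rewrite mulr0.
    case: nT; have il : (i * d <= j + e * d)%N by rewrite -li.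
    have -> : (j + e * d = (j + e * d - i * d + e * d) + (i - e) * d)%N.
      by rewrite mulnBl; nia.
    by apply/Tm/IH => //; nia.
  by case/eqP: lne; apply/val_inj; rewrite /= li ei.
move=> E; apply: nT; apply: TF; rewrite E mulf_neq0 //.
Qed.

(** * The semigroup of a projective monomial curve *)

Section Curve.
Variables (n d : nat) (A : n.-tuple nat).
Hypotheses (n1 : (1 < n)%N) (sA : sorted ltn A) (A0 : nth 0%N A 0 = 0%N)
  (Ad : nth 0%N A n.-1 = d)
  (gA : (\big[gcdn/0%N]_(1 <= i < n) nth 0%N A i)%N = 1%N).

Local Notation a0 := (vec A d 0).
Local Notation a1 := (vec A d n.-1).

Lemma vec_first : a0 = (0, d%:Z).
Proof. by rewrite /vec A0 subr0. Qed.

Lemma vec_last : a1 = (d%:Z, 0).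
Proof. by rewrite /vec Ad subrr. Qed.

Lemma exponent_le i : (i < n)%N -> (nth 0%N A i <= d)%N.
Proof.
move=> ni; rewrite -Ad.
apply: (sorted_leq_nth leq_trans leqnn) => //; rewrite ?inE ?size_tuple; try lia.
by apply: sub_sorted sA => x y /ltnW.
Qed.

Lemma degree_gt0 : (0 < d)%N.
Proof.
rewrite -Ad; apply: leq_ltn_trans (_ : nth 0%N A 0 <  _)%N => //.
by apply: (sorted_ltn_nth ltn_trans) => //; rewrite ?inE ?size_tuple; lia.
Qed.

Lemma Sgp_vec i : (i < n)%N -> Sgp A d (vec A d i).
Proof. by move=> ni; have := semigroup_gen_gen (fun i : 'I_n => vec A d i) (Ordinal ni). Qed.

Lemma Sgp_first : Sgp A d a0. Proof. by apply: Sgp_vec; lia. Qed.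
Lemma Sgp_last : Sgp A d a1. Proof. by apply: Sgp_vec; lia. Qed.

Lemma sum_vecE (c : 'I_n -> nat) :
  \sum_(i < n) vec A d i *+ c i =
  (\sum_(i < n) (tnth A i)%:Z *+ c i, \sum_(i < n) (d%:Z - (tnth A i)%:Z) *+ c i).
Proof.
rewrite [LHS]surjective_pairing; congr (_, _).
  rewrite (raddf_sum (@fst int int)); apply: eq_bigr => i _.
  by rewrite (raddfMn (@fst int int)) /= (tnth_nth 0%N).
rewrite (raddf_sum (@snd int int)); apply: eq_bigr => i _.
by rewrite (raddfMn (@snd int int)) /= (tnth_nth 0%N).
Qed.

Lemma S1_ge0 x : S1 A x -> 0 <= x.
Proof. by case=> c ->; apply: sumr_ge0 => i _; rewrite mulrn_wge0. Qed.

Lemma S2_ge0 x : S2 A d x -> 0 <= x.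
Proof.
case=> c ->; apply: sumr_ge0 => i _; rewrite mulrn_wge0 // subr_ge0.
by rewrite lez_nat (tnth_nth 0%N) exponent_le.
Qed.

Lemma Sgp_S1 p : Sgp A d p -> S1 A p.1.
Proof. by case=> c ->; exists c; rewrite sum_vecE. Qed.

Lemma Sgp_S2 p : Sgp A d p -> S2 A d p.2.
Proof. by case=> c ->; exists c; rewrite sum_vecE. Qed.

Lemma Sgp_dvd p : Sgp A d p -> (d%:Z %| p.1 + p.2)%Z.
Proof.
case=> c ->; rewrite sum_vecE /= -big_split /=; apply: rpred_sum => i _.
by rewrite -mulrnDl addrC subrK rpredMn // dvdzz.
Qed.

(** Bezout for the [a_i] writes the first coordinate; the second one is then
    corrected by a multiple of [a_0], which does not move the first. *)
Lemma GgpP p : Ggp A d p <-> (d%:Z %| p.1 + p.2)%Z.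
Proof.
pose i0 := Ordinal (ltnW n1).
have sumE (c : 'I_n -> int) : \sum_(i < n) vec A d i *~ c i =
  (\sum_(i < n) (nth 0%N A i)%:Z * c i,
   \sum_(i < n) (d%:Z - (nth 0%N A i)%:Z) * c i).
  rewrite [LHS]surjective_pairing; congr (_, _).
    rewrite (raddf_sum (@fst int int)); apply: eq_bigr => i _.
    by rewrite (raddfMz (@fst int int)) /= mulrzz.
  rewrite (raddf_sum (@snd int int)); apply: eq_bigr => i _.
  by rewrite (raddfMz (@snd int int)) /= mulrzz.
split=> [[c ->]|/dvdzP [q pq]].
  rewrite sumE /= -big_split /=; apply: rpred_sum => i _.
  by rewrite -mulrDl addrC subrK dvdz_mulr.
have [c cE] := bezout_big_gcdn (fun i => nth 0%N A i) 1 n.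
have {}cE : \sum_(i < n | i != i0) (nth 0%N A i)%:Z * c i = 1.
  rewrite -[RHS]/(Posz 1) -gA -cE big_geq_mkord /=; apply: eq_bigl => i.
  by rewrite -val_eqE /= lt0n.
pose e := \sum_(i < n | i != i0) p.1 * c i.
exists (fun i => if i == i0 then q - e else p.1 * c i).
have s1 : \sum_(i < n | i != i0) (nth 0%N A i)%:Z *
   (if i == i0 then q - e else p.1 * c i) = p.1.
  rewrite -[RHS]mulr1 -cE mulr_sumr; apply: eq_bigr => i /negPf ->.
  by rewrite mulrCA.
rewrite sumE [p in LHS]surjective_pairing; congr (_, _).
  by rewrite (bigD1 i0) //= s1 A0 mul0r add0r.
rewrite (bigD1 i0) //= A0 subr0.
under eq_bigr do rewrite mulrBl.
rewrite sumrB s1.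
under eq_bigr => i /negPf -> do [].
by rewrite -mulr_sumr -/e; nia.
Qed.

Lemma int_pair_mulrn (x y : int) m : (x, y) *+ m = (m%:Z * x, m%:Z * y).
Proof.
elim: m => [|m IH]; first by rewrite mulr0n !mul0r.
by rewrite mulrS IH; congr (_, _); rewrite intS mulrDl mul1r.
Qed.

Lemma shiftE p i j :
  p + a0 *+ i + a1 *+ j = (p.1 + j%:Z * d%:Z, p.2 + i%:Z * d%:Z).
Proof.
by case: p => x y; rewrite vec_first vec_last !int_pair_mulrn; congr (_, _) => /=; lia.
Qed.

Lemma shift_first p i : p + a0 *+ i = (p.1, p.2 + i%:Z * d%:Z).
Proof. by have := shiftE p i 0; rewrite mulr0n !mul0r !addr0. Qed.

Lemma shift_last p j : p + a1 *+ j = (p.1 + j%:Z * d%:Z, p.2).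
Proof. by have := shiftE p 0 j; rewrite mulr0n !mul0r !addr0. Qed.

Lemma shift_pred_first p i j :
  p + a0 *+ i.+1 + a1 *+ j - a0 = p + a0 *+ i + a1 *+ j.
Proof.
by rewrite !shiftE vec_first; congr (_, _) => /=; rewrite ?intS ?mulrDl; lia.
Qed.

Lemma shift_pred_last p i j :
  p + a0 *+ i + a1 *+ j.+1 - a1 = p + a0 *+ i + a1 *+ j.
Proof. by rewrite mulrSr addrA addrK. Qed.

Lemma Sgp_shift p i j : Sgp A d p -> Sgp A d (p + a0 *+ i + a1 *+ j).
Proof.
move=> Sp; apply: semigroup_genD; [apply: semigroup_genD => // |];
  apply: semigroup_genMn; [exact: Sgp_first | exact: Sgp_last].
Qed.

Lemma Sgp_descent p : Sgp A d p ->
  exists (e : int * int) (i j : nat), AP_S A d e /\ p = e + a0 *+ i + a1 *+ j.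
Proof.
have S0 q : Sgp A d q -> 0 <= q.1 /\ 0 <= q.2.
  by move=> Sq; split; [apply: S1_ge0; exact: Sgp_S1 | apply: S2_ge0; exact: Sgp_S2].
have d0 := degree_gt0.
have [m] := ubnP `|(p.1 + p.2)%R|%N; elim: m p => // m IH p pm Sp.
have [p1 p2] := S0 _ Sp.
have [Sp0|nSp0] := classic (Sgp A d (p - a0)).
  have [q1 q2] := S0 _ Sp0; have [|e [i [j [Ae E]]]] := IH _ _ Sp0.
    by move: q1 q2; rewrite vec_first /=; lia.
  exists e, i.+1, j; split=> //.
  by rewrite -[p](subrK a0) E mulrSr; rewrite -!addrA; congr (_ + (_ + _)); rewrite addrC.
have [Sp1|nSp1] := classic (Sgp A d (p - a1)).
  have [q1 q2] := S0 _ Sp1; have [|e [i [j [Ae E]]]] := IH _ _ Sp1.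
    by move: q1 q2; rewrite vec_last /=; lia.
  by exists e, i, j.+1; split=> //; rewrite -[p](subrK a1) E mulrSr addrA.
by exists p, 0%N, 0%N; rewrite !mulr0n !addr0.
Qed.

(** The form in which the equality of the semigroup with [Sgp'] enters the ring
    theory: a monomial multiplied into the ring both by a power of [x_0] and by a
    power of [x_(n-1)] belongs to the ring. *)
Definition saturated : Prop := forall p i j,
  Sgp A d (p + a0 *+ i) -> Sgp A d (p + a1 *+ j) -> Sgp A d p.

Lemma Sgp_Sgp' p : Sgp A d p -> Sgp' A d p.
Proof.
move=> Sp; split; [|exact: Sgp_S1|exact: Sgp_S2].
by apply/GgpP; exact: Sgp_dvd.
Qed.

Lemma lift_S1 x : S1 A x -> exists y, Sgp A d (x, y).
Proof. by case=> c ->; eexists; exists c; rewrite sum_vecE. Qed.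

Lemma lift_S2 y : S2 A d y -> exists x, Sgp A d (x, y).
Proof. by case=> c ->; eexists; exists c; rewrite sum_vecE. Qed.

(** Lifts of the coordinates to the semigroup differ from [p] by multiples of
    [d] in the other coordinate, as both lie in the group. *)
Lemma Sgp'_shift p : Sgp' A d p ->
  exists i j, Sgp A d (p + a0 *+ i) /\ Sgp A d (p + a1 *+ j).
Proof.
case: p => x y [/GgpP /= /dvdzP [q xy] /lift_S1 [y' Sy] /lift_S2 [x' Sx]].
have /dvdzP [q1 /= e1] := Sgp_dvd Sy; have /dvdzP [q2 /= e2] := Sgp_dvd Sx.
exists (absz (q1 - q)), (absz (q2 - q)); split.
  have := Sgp_shift (absz (Posz (absz (q1 - q)) + q - q1)%R) 0 Sy.
  rewrite shiftE shift_first /=.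
  by congr (Sgp _ _ (_, _)); rewrite ?mul0r ?addr0 // gez0_abs ?mulrBl ?mulrDl; lia.
have := Sgp_shift 0 (absz (Posz (absz (q2 - q)) + q - q2)%R) Sx.
rewrite shiftE shift_last /=.
by congr (Sgp _ _ (_, _)); rewrite ?mul0r ?addr0 // gez0_abs ?mulrBl ?mulrDl; lia.
Qed.

Lemma saturated_Sgp' : saturated -> forall p, Sgp' A d p <-> Sgp A d p.
Proof.
move=> sat p; split; last exact: Sgp_Sgp'.
by move=> /Sgp'_shift [i [j [Si Sj]]]; exact: sat Si Sj.
Qed.

Lemma Sgp'_saturated : (forall p, Sgp' A d p <-> Sgp A d p) -> saturated.
Proof.
move=> S'S p i j Si Sj; apply/S'S.
have ei := shift_first p i; have ej := shift_last p j.
split.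
- by apply/GgpP; have := Sgp_dvd Si; rewrite ei /= addrA rpredDr ?dvdz_mull.
- by have := Sgp_S1 Si; rewrite ei.
- by have := Sgp_S2 Sj; rewrite ej.
Qed.

(** The hypothesis is the case of one step in each direction; the steps are added
    one at a time. *)
Lemma no_E_S_saturated : (forall p, ~ E_S A d p) -> saturated.
Proof.
move=> noE.
have step q : Sgp A d (q + a0) -> Sgp A d (q + a1) -> Sgp A d q.
  move=> S0 S1; apply: NNPP => nS; apply: (noE (q + a0 + a1)).
  have S01 := semigroup_genD S0 Sgp_last.
  split; rewrite ?addrK //; first by rewrite addrAC addrK.
  by rewrite addrAC addrK addrK.
have step1 q j : Sgp A d (q + a0) -> Sgp A d (q + a1 *+ j) -> Sgp A d q.
  elim: j => [|j IH] S0; first by rewrite mulr0n addr0.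
  rewrite mulrSr addrA => S1; apply: (IH S0); apply: step => //.
  rewrite addrAC; apply: semigroup_genD => //.
  by apply: semigroup_genMn; exact: Sgp_last.
move=> p i j; elim: i => [|i IH]; first by rewrite mulr0n addr0.
rewrite mulrSr addrA => Si Sj; apply: (IH _ Sj); apply: (step1 _ j) => //.
rewrite addrAC; apply: semigroup_genD => //.
by apply: semigroup_genMn; exact: Sgp_first.
Qed.

(** * Pairs of Apery elements with opposite residues *)

Section AperyPairs.
Variables r t : nat -> int.
Hypotheses (rP : Apery_enum (S1 A) d r) (tP : Apery_enum (S2 A d) d t).

Lemma enum_S1 i : (i < d)%N -> S1 A (r i).
Proof. by case: rP => _ _ AE id; have /AE [] : exists2 j, (j < d)%N & r i = r j by exists i. Qed.

Lemma enum_S2 i : (i < d)%N -> S2 A d (t i).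
Proof. by case: tP => _ _ AE id; have /AE [] : exists2 j, (j < d)%N & t i = t j by exists i. Qed.

(** The pairs [(r_i, t_(d-i))], with the remainder modulo [d] taken so that the
    pair of the class of [0] is [(r_0, t_0) = (0, 0)]. *)
Definition apery_pair i := (r i, t ((d - i) %% d)%N).

Lemma apery_pair_dvd i : (i < d)%N ->
  (d%:Z %| (apery_pair i).1 + (apery_pair i).2)%Z.
Proof.
move=> id; have d0 := degree_gt0; case: rP => _ rE _; case: tP => _ tE _.
rewrite /apery_pair /=; have /eqz_modP [u ->] := rE _ id.
have /eqz_modP [v /= ->] := tE _ (ltn_pmod (d - i) d0).
apply/dvdzP.
have [->|i0] := posnP i.
  by exists (u + v); rewrite subn0 modnn mulrDl; lia.
by exists (u + v + 1); rewrite modn_small ?mulrDl; lia.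
Qed.

Lemma Sgp'_apery_pair i : (i < d)%N -> Sgp' A d (apery_pair i).
Proof.
move=> id; split; [|exact: enum_S1|apply: enum_S2].
  by apply/GgpP; exact: apery_pair_dvd.
by rewrite ltn_pmod // degree_gt0.
Qed.

(** Each coordinate descends separately to its Apery element, and since the point
    lies in the group the two residues are opposite. *)
Lemma Sgp'_decomp p : Sgp' A d p ->
  exists i l m, (i < d)%N /\ p = apery_pair i + a0 *+ l + a1 *+ m.
Proof.
case: p => x y [/GgpP /= xy Sx Sy]; have d0 := degree_gt0.
have dZ : 0 < d%:Z by lia.
pose i := `|(x %% d%:Z)%Z|%N.
have iE : i%:Z = (x %% d%:Z)%Z by rewrite gez0_abs // modz_ge0 // lt0r_neq0.
have id : (i < d)%N by rewrite -ltz_nat iE ltz_pmod.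
have [|m xE] := Apery_enum_descent d0 S1_ge0 rP Sx id.
  by rewrite iE modz_mod.
have yi : (y = ((d - i) %% d)%N%:Z %[mod d%:Z])%Z.
  have /dvdzP [q e] := xy.
  have ix : x = i%:Z + (x %/ d%:Z)%Z * d%:Z by rewrite iE addrC -divz_eq.
  move: (x %/ d%:Z)%Z ix => D ix {iE}; have yE : y = (q - D) * d%:Z - i%:Z.
    by rewrite mulrBl -e ix; lia.
  apply/eqz_modP; have [i0|i0] := posnP i.
    by exists (q - D); rewrite yE i0 subn0 modnn; lia.
  by exists (q - D - 1); rewrite yE modn_small ?[in RHS]mulrBl; lia.
have [l yE] := Apery_enum_descent d0 S2_ge0 tP Sy (ltn_pmod _ d0) yi.
by exists i, l, m; split=> //; rewrite shiftE /= -xE -yE.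
Qed.

Definition apery_pairs_in := forall i, (i < d)%N -> Sgp A d (apery_pair i).

Lemma apery_pairs_inP :
  (forall i, (1 <= i < d)%N -> Sgp A d (r i, t (d - i)%N)) <-> apery_pairs_in.
Proof.
have d0 := degree_gt0; split=> H i.
  move=> id; have [->|i0] := posnP i.
    rewrite /apery_pair subn0 modnn; case: rP => -> _ _; case: tP => -> _ _.
    exact: semigroup_gen0.
  have := H i; rewrite i0 id => /(_ isT).
  by rewrite /apery_pair modn_small //; lia.
move=> /andP [i0 id]; have := H i id.
by rewrite /apery_pair modn_small //; lia.
Qed.

Lemma Apery_pair_AP_S q1 q2 : Apery (S1 A) d q1 -> Apery (S2 A d) d q2 ->
  Sgp A d (q1, q2) -> AP_S A d (q1, q2).
Proof.
move=> [_ n1q] [_ n2q] S12; split=> //.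
  by move/Sgp_S2; rewrite vec_first.
by move/Sgp_S1; rewrite vec_last.
Qed.

Lemma apery_pair_of q1 q2 : Apery (S1 A) d q1 -> Apery (S2 A d) d q2 ->
  (q1 + q2 = 0 %[mod d%:Z])%Z -> exists2 i, (i < d)%N & (q1, q2) = apery_pair i.
Proof.
move=> [Sq1 nq1] [Sq2 nq2] e.
have [|i [l [m [id]]]] := @Sgp'_decomp (q1, q2).
  split=> //; apply/GgpP => /=.
  by rewrite -[_ + _]subr0 -eqz_mod_dvd; apply/eqP.
have addd (S : 'I_n -> int) x y (k : nat) : semigroup_gen S d%:Z -> semigroup_gen S x ->
    ~ semigroup_gen S (y - d%:Z) -> y = x + k%:Z * d%:Z -> y = x.
  case: k => [|k] dS Sx nSy yE; first by rewrite yE mul0r addr0.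
  case: nSy; have -> : y - d%:Z = x + d%:Z *+ k.
    by rewrite yE intS mulrDl mul1r -mulr_natl natz; lia.
  by apply: semigroup_genD => //; exact: semigroup_genMn.
rewrite shiftE => -[e1 e2]; exists i => //; rewrite [RHS]surjective_pairing; congr (_, _).
  apply: (addd _ _ _ _ _ _ nq1 e1); last exact: enum_S1.
  by have := Sgp_S1 Sgp_last; rewrite vec_last.
apply: (addd _ _ _ _ _ _ nq2 e2); first by have := Sgp_S2 Sgp_first; rewrite vec_first.
by apply: enum_S2; rewrite ltn_pmod // degree_gt0.
Qed.

Lemma apery_pair_Apery i : (i < d)%N ->
  Apery (S1 A) d (apery_pair i).1 /\ Apery (S2 A d) d (apery_pair i).2.
Proof.
move=> id; case: rP => _ _ rA; case: tP => _ _ tA; split; first by apply/rA; exists i.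
by apply/tA; exists ((d - i) %% d)%N => //; rewrite ltn_pmod // degree_gt0.
Qed.

Lemma apery_pairs_AP_S : apery_pairs_in -> forall q1 q2 : int,
  Apery (S1 A) d q1 -> Apery (S2 A d) d q2 ->
  (q1 + q2 = 0 %[mod d%:Z])%Z -> AP_S A d (q1, q2).
Proof.
move=> H q1 q2 A1 A2 e; have [i id E] := apery_pair_of A1 A2 e.
by apply: Apery_pair_AP_S => //; rewrite E; exact: H.
Qed.

Lemma AP_S_apery_pairs :
  (forall q1 q2 : int, Apery (S1 A) d q1 -> Apery (S2 A d) d q2 ->
    (q1 + q2 = 0 %[mod d%:Z])%Z -> AP_S A d (q1, q2)) ->
  forall p, AP_S A d p <-> exists2 i, (i < d)%N & p = apery_pair i.
Proof.
move=> H p; have AP i : (i < d)%N -> AP_S A d (apery_pair i).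
  move=> id; have [A1 A2] := apery_pair_Apery id; apply: H => //.
  by apply/eqP; rewrite eqz_mod_dvd subr0; exact: apery_pair_dvd.
split=> [[Sp n0 n1']|[i id ->]]; last exact: AP.
have [i [l [m [id E]]]] := Sgp'_decomp (Sgp_Sgp' Sp).
exists i => //; have [Si _ _] := AP i id.
case: l E => [|l] E.
  case: m E => [|m] E; first by rewrite E !mulr0n !addr0.
  by case: n1'; rewrite E shift_pred_last; exact: Sgp_shift.
by case: n0; rewrite E shift_pred_first; exact: Sgp_shift.
Qed.

Lemma apery_pairP p : (exists2 i, (i < d)%N & p = apery_pair i) <->
  p = (0, 0) \/ exists2 i, (1 <= i < d)%N & p = (r i, t (d - i)%N).
Proof.
have d0 := degree_gt0.
have pair0 : apery_pair 0 = (0, 0).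
  by rewrite /apery_pair subn0 modnn; case: rP => -> _ _; case: tP => -> _ _.
have pairE i : (1 <= i < d)%N -> apery_pair i = (r i, t (d - i)%N).
  by move=> id; rewrite /apery_pair modn_small //; lia.
split=> [[i id ->]|[->|[i id ->]]]; last 1 first.
- by exists i; [lia | rewrite pairE].
- have [->|i0] := posnP i; [by left | right; exists i; rewrite ?i0 //].
  by rewrite pairE // i0.
- by exists 0%N.
Qed.

Lemma enum_first_inj i j : (i < d)%N -> (j < d)%N -> (d%:Z %| r i - r j)%Z -> i = j.
Proof.
case: rP => _ rE _ id jd; rewrite -eqz_mod_dvd => /eqP; rewrite !rE //.
by rewrite !modz_nat !modn_small // => -[].
Qed.

Lemma apery_pairs_count :
  (forall p, AP_S A d p <-> exists2 i, (i < d)%N & p = apery_pair i) ->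
  exists s : seq (int * int),
    [/\ uniq s, size s = d & forall p, p \in s <-> AP_S A d p].
Proof.
move=> H; exists [seq apery_pair i | i <- iota 0 d]; split.
- rewrite map_inj_in_uniq ?iota_uniq // => i j; rewrite !mem_iota => id jd [e _].
  by apply: enum_first_inj; rewrite ?e ?subrr.
- by rewrite size_map size_iota.
move=> p; split.
  by case/mapP=> i; rewrite mem_iota => id ->; apply/H; exists i.
by case/H=> i id ->; apply: map_f; rewrite mem_iota.
Qed.

(** Every residue class mod [d] of the first coordinate meets the Apery set, so
    with only [d] elements it meets each class once.  Two descents from one
    point [p], beginning with [p - a_0] and [p - a_(n-1)], must then end at the
    same point, and comparing them shows that [p - a_0 - a_(n-1)] lies in the
    semigroup. *)
Lemma count_no_E_S :
  (exists s : seq (int * int),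
    [/\ uniq s, size s = d & forall p, p \in s <-> AP_S A d p]) ->
  forall p, ~ E_S A d p.
Proof.
move=> [s [us ss sE]]; have d0 := degree_gt0; have dZ : d%:Z != 0 by lia.
pose cl (p : int * int) := `|(p.1 %% d%:Z)%Z|%N.
have cl_shift e i j : cl (e + a0 *+ i + a1 *+ j) = cl e.
  by rewrite shiftE /cl /= addrC modzMDl.
have sub : {subset iota 0 d <= [seq cl p | p <- s]}.
  move=> i; rewrite mem_iota /= => id; have [y Sy] := lift_S1 (enum_S1 id).
  have [e [l [m [Ae E]]]] := Sgp_descent Sy.
  have -> : i = cl e.
    rewrite -(cl_shift e l m) -E /cl /=; case: rP => _ rE _.
    by rewrite rE // modz_nat modn_small.
  by apply: map_f; apply/sE.
have cl_inj : {in s &, injective cl}.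
  apply: uniq_map_inj; apply: leq_size_uniq (iota_uniq 0 d) sub _.
  by rewrite size_map size_iota ss.
move=> p [Sp S0 S1 nS]; case: nS.
have [e [i [j [/sE es E]]]] := Sgp_descent S0.
have [e' [i' [j' [/sE es' E']]]] := Sgp_descent S1.
have ee : e = e'.
  apply: cl_inj => //; rewrite -(cl_shift e i j) -(cl_shift e' i' j') -E -E'.
  rewrite vec_first vec_last /cl; congr (absz _); apply/eqz_modP; exists 1.
  by case: (p) => x y /=; lia.
subst e'; have jj : j = j'.+1.
  move: E E'; rewrite !shiftE vec_first vec_last => -[e1 _] [e2 _].
  by move: e1 e2 => /= e1 e2; nia.
by rewrite E jj shift_pred_last; apply: Sgp_shift; have /sE [] := es.
Qed.

End AperyPairs.

(** * The coordinate ring as a subring of the polynomial ring *)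

Variable k : fieldType.

Definition SgpN (i j : nat) : Prop := Sgp A d (i%:Z, j%:Z).

Local Notation a_ i := (tnth A i).

Lemma tnth_le (i : 'I_n) : (a_ i <= d)%N.
Proof. by rewrite (tnth_nth 0%N) exponent_le. Qed.

Lemma SgpNP i j : SgpN i j <-> exists c : 'I_n -> nat,
  i = (\sum_l a_ l * c l)%N /\ j = (\sum_l (d - a_ l) * c l)%N.
Proof.
have E (c : 'I_n -> nat) : \sum_(l < n) vec A d l *+ c l =
    ((\sum_l a_ l * c l)%N%:Z, (\sum_l (d - a_ l) * c l)%N%:Z).
  rewrite sum_vecE !(big_morph Posz PoszD (erefl _)); congr (_, _).
    by apply: eq_bigr => l _; rewrite PoszM -mulr_natr natz.
  apply: eq_bigr => l _; rewrite PoszM -mulr_natr natz; congr (_ * _).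
  by have := tnth_le l; lia.
split=> [[c]|[c [-> ->]]]; last by exists c; rewrite E.
by rewrite E => -[-> ->]; exists c.
Qed.

Definition curve_param : {rmorphism {mpoly k[n]} -> {poly {poly k}}} :=
  @to_plane k \o comp_mpoly (monomial_param k A d).

Lemma curve_param_eq0 p : curve_param p = 0 <-> p \in @curve_ideal k n A d.
Proof.
rewrite unfold_in /curve_ideal; split=> [|/eqP p0]; last by rewrite /curve_param /= p0 raddf0.
by rewrite -(raddf0 (@to_plane k)) => /to_plane_inj ->.
Qed.

Lemma curve_paramX m : curve_param 'X_[m] =
  plane_mon k (\sum_i a_ i * m i)%N (\sum_i (d - a_ i) * m i)%N.
Proof.
rewrite /curve_param /= comp_mpolyX -plane_mon_prod rmorph_prod; apply: eq_bigr => i _.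
rewrite rmorphXn tnth_mktuple -plane_monX; congr (_ ^+ _).
rewrite rmorphM !rmorphXn !to_planeX !mnm1E /= !plane_monX plane_monM.
by rewrite !mul0n !mul1n addn0 add0n.
Qed.

Local Notation R := (coord_ring k A d).

Definition curve_pi : {rmorphism {mpoly k[n]} -> R} :=
  \pi_({ideal_quot (@curve_ideal k n A d)})%qT.

Lemma curve_pi_surj r : exists p, curve_pi p = r.
Proof. by exists (repr (r : {ideal_quot (@curve_ideal k n A d)})); exact: reprK. Qed.

Lemma curve_pi_eq p q : curve_pi p = curve_pi q <-> curve_param p = curve_param q.
Proof.
have memE : (p - q \in @curve_ideal k n A d) =
    (curve_pi p == curve_pi q :> {ideal_quot (@curve_ideal k n A d)}).
  exact: Quotient.idealrBE.
have paramE : curve_param (p - q) = curve_param p - curve_param q := rmorphB curve_param p q.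
split=> [/eqP|pq].
  rewrite -memE => /curve_param_eq0; rewrite paramE => /eqP.
  by rewrite subr_eq0 => /eqP.
by apply/eqP; rewrite -memE; apply/curve_param_eq0; rewrite paramE pq subrr.
Qed.

(** The value is independent of the representative because the curve ideal is
    the kernel of the parametrisation. *)
Definition curve_embed (r : R) : {poly {poly k}} :=
  curve_param (repr (r : {ideal_quot (@curve_ideal k n A d)})).

Lemma curve_embed_pi p : curve_embed (curve_pi p) = curve_param p.
Proof. by apply/curve_pi_eq; exact: reprK. Qed.

Lemma curve_embed_inj : injective curve_embed.
Proof.
move=> r s; have [p <-] := curve_pi_surj r; have [q <-] := curve_pi_surj s.
by rewrite !curve_embed_pi => /curve_pi_eq.
Qed.

Lemma curve_embed_is_zmod_morphism : zmod_morphism curve_embed.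
Proof.
move=> r s; have [p <-] := curve_pi_surj r; have [q <-] := curve_pi_surj s.
by rewrite -rmorphB !curve_embed_pi rmorphB.
Qed.

Lemma curve_embed_is_monoid_morphism : monoid_morphism curve_embed.
Proof.
split=> [|r s]; first by rewrite -(rmorph1 curve_pi) curve_embed_pi rmorph1.
have [p <-] := curve_pi_surj r; have [q <-] := curve_pi_surj s.
by rewrite -rmorphM !curve_embed_pi rmorphM.
Qed.

HB.instance Definition _ := GRing.isZmodMorphism.Build R {poly {poly k}} curve_embed curve_embed_is_zmod_morphism.
HB.instance Definition _ := GRing.isMonoidMorphism.Build R {poly {poly k}} curve_embed curve_embed_is_monoid_morphism.

Definition curve_const : {rmorphism k -> R} := curve_pi \o @mpolyC n k.

Lemma curve_embed_const c : curve_embed (curve_const c) = c%:P%:P.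
Proof.
by rewrite curve_embed_pi /curve_param /= comp_mpolyC /to_plane /= mmapC.
Qed.

Definition coord (i : 'I_n) : R := curve_pi 'X_i.

Lemma curve_embed_coord i : curve_embed (coord i) = plane_mon k (a_ i) (d - a_ i).
Proof.
rewrite curve_embed_pi curve_paramX (bigD1 i) //= mnm1E eqxx muln1 big1 ?addn0 => [|j ji].
  rewrite (bigD1 i) //= mnm1E eqxx muln1 big1 ?addn0 // => j ji.
  by rewrite mnm1E eq_sym (negPf ji) muln0.
by rewrite mnm1E eq_sym (negPf ji) muln0.
Qed.

(** Polynomials all of whose monomials are points of the semigroup; by the next
    lemma they form the coordinate ring. *)
Definition in_Sgp (z : {poly {poly k}}) := forall i j, z`_i`_j != 0 -> SgpN i j.

Lemma curve_embed_image z : (exists r, curve_embed r = z) <-> in_Sgp z.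
Proof.
split=> [[r <-] i j|zS].
  have [p <-] := curve_pi_surj r; rewrite curve_embed_pi [p]mpolyE rmorph_sum.
  rewrite !coef_sum => nz; apply: NNPP => nS; case/eqP: nz; apply: big1 => m _.
  rewrite -mul_mpolyC rmorphM curve_paramX /curve_param /= comp_mpolyC /to_plane /= mmapC.
  rewrite coefCM coefCM coef_plane_mon; case: andP => [[/eqP ei /eqP ej]|]; last by rewrite mulr0.
  by case: nS; rewrite ei ej; apply/SgpNP; exists m.
have mon i j : SgpN i j -> exists r, curve_embed r = plane_mon k i j.
  move=> /SgpNP [c [-> ->]]; exists (curve_pi 'X_[[multinom c i | i < n]]).
  rewrite curve_embed_pi curve_paramX; congr (plane_mon _ _ _); apply: eq_bigr => l _; by rewrite mnmE.
have sum (I : finType) (F : I -> {poly {poly k}}) :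
    (forall x, exists r, curve_embed r = F x) -> exists r, curve_embed r = \sum_x F x.
  move=> FE; apply: (big_ind (fun w => exists r, curve_embed r = w)) => [||x _]; [by exists 0; rewrite rmorph0 | | exact: FE].
  by move=> _ _ [r <-] [s <-]; exists (r + s); rewrite rmorphD.
have -> : z = \sum_(i < size z) \sum_(j < size z`_i) (z`_i`_j)%:P%:P * plane_mon k i j.
  rewrite -[LHS]coefK poly_def; apply: eq_bigr => i _.
  rewrite -[in LHS](coefK z`_i) poly_def -mul_polyC rmorph_sum mulr_suml.
  apply: eq_bigr => j _; rewrite /plane_mon mulrA; congr (_ * _).
  by rewrite -mul_polyC rmorphM.
apply: (sum) => i; apply: (sum) => j.
have [z0|/zS /mon [r rE]] := eqVneq (z`_i`_j) 0.
  by exists 0; rewrite z0 rmorph0 mul0r.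
by exists (curve_const (z`_i`_j) * r); rewrite rmorphM /= curve_embed_const rE.
Qed.

(** * Saturated semigroups have Cohen-Macaulay coordinate rings *)

Let d0 : (0 < d)%N := degree_gt0.

Definition index_first : 'I_n := Ordinal (ltnW n1).
Definition index_last : 'I_n := Ordinal (eq_ind_r (fun m => (m <= n)%N) (leqnn n) (prednK (ltnW n1))).

Local Notation x := (coord index_first).
Local Notation y := (coord index_last).

Lemma curve_embed_x : curve_embed x = ('X^d)%:P.
Proof. by rewrite curve_embed_coord (tnth_nth 0%N) A0 subn0 /plane_mon mulr1. Qed.

Lemma curve_embed_y : curve_embed y = 'X^d.
Proof. by rewrite curve_embed_coord (tnth_nth 0%N) /= Ad subnn /plane_mon mul1r. Qed.

Lemma curve_embed_eval1_x (f : {poly k}) : curve_embed (eval1 curve_const x f) = (f \Po 'X^d)%:P.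
Proof.
rewrite -[in LHS](coefK f) eval1_poly rmorph_sum comp_polyE rmorph_sum.
apply: eq_bigr => i _; rewrite rmorphM /= curve_embed_const rmorphXn /= curve_embed_x.
by rewrite -mul_polyC /= polyCM -polyC_exp.
Qed.

Lemma curve_embed_eval1_y (g : {poly k}) : curve_embed (eval1 curve_const y g) = map_poly polyC (g \Po 'X^d).
Proof.
rewrite -[in LHS](coefK g) eval1_poly rmorph_sum comp_polyE rmorph_sum.
apply: eq_bigr => i _; rewrite rmorphM /= curve_embed_const rmorphXn /= curve_embed_y.
by rewrite map_polyZ rmorphXn /= map_polyXn mul_polyC.
Qed.

Lemma SgpN_x i j : SgpN i j -> SgpN i (j + d).
Proof.
move=> S; have := semigroup_genD S Sgp_first; rewrite vec_first.
by rewrite /SgpN PoszD; congr (Sgp _ _ (_, _)); rewrite addr0.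
Qed.

Lemma SgpN_y i j : SgpN i j -> SgpN (i + d) j.
Proof.
move=> S; have := semigroup_genD S Sgp_last; rewrite vec_last.
by rewrite /SgpN PoszD; congr (Sgp _ _ (_, _)); rewrite addr0.
Qed.

Lemma coord_expd i : coord i ^+ d = x ^+ (d - tnth A i) * y ^+ tnth A i.
Proof.
apply: curve_embed_inj; rewrite rmorphM !rmorphXn /= curve_embed_x curve_embed_y curve_embed_coord.
by rewrite plane_monX /plane_mon -!exprM !(mulnC d) -rmorphXn -exprM mulnC.
Qed.

Definition span_mon (t : {ffun 'I_n -> 'I_d}) : R := \prod_i coord i ^+ t i.

(** The [d]-th power of each [x_i] is a monomial in [x_0] and [x_(n-1)], so the
    monomials with all exponents below [d] span the ring as a module over
    [k[x_0, x_(n-1)]]. *)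
Lemma span_xy (E : R -> Prop) : (forall a b, E a -> E b -> E (a + b)) ->
  (forall c i j t, E (curve_const c * x ^+ i * y ^+ j * span_mon t)) -> forall a, E a.
Proof.
move=> ED Emon a; have [p <-] := curve_pi_surj a.
have E0 : E 0.
  have := Emon 0 0%N 0%N [ffun => Ordinal d0].
  by rewrite rmorph0 !mul0r.
rewrite [p]mpolyE rmorph_sum; apply: big_ind => [//|//|m _].
rewrite -mul_mpolyC rmorphM /= -/(curve_const _).
have -> : curve_pi 'X_[m] = x ^+ (\sum_i (d - tnth A i) * (m i %/ d))
    * y ^+ (\sum_i tnth A i * (m i %/ d))
    * span_mon [ffun i => Ordinal (ltn_pmod (m i) d0)].
  rewrite !expr_sum -!big_split /= mpolyXE_id rmorph_prod; apply: eq_bigr => i _.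
  rewrite ffunE /= {1}(divn_eq (m i) d) mulnC rmorphXn exprD exprM -/(coord _).
  by rewrite coord_expd exprMn -!exprM.
by rewrite !mulrA; exact: Emon.
Qed.

Lemma coord_ring_noetherian : noetherian R.
Proof. exact: noetherian_surj curve_pi_surj (@mpoly_noetherian k n). Qed.

Lemma x_neq0 : x != 0.
Proof.
apply/eqP => /(congr1 curve_embed)/eqP; rewrite curve_embed_x rmorph0 polyC_eq0.
by rewrite -size_poly_eq0 size_polyXn.
Qed.

(** The value at the origin [u = v = 0]; its kernel is the irrelevant ideal. *)
Definition origin : {rmorphism R -> k} := horner_eval 0 \o horner_eval 0 \o curve_embed.

Lemma originE r : origin r = (curve_embed r)`_0`_0.
Proof. by rewrite /origin /= /horner_eval !horner_coef0. Qed.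

Lemma origin_x : origin x = 0.
Proof. by rewrite originE curve_embed_x coefC /= coefXn ltn_eqF. Qed.

(** Otherwise the ring would be a field, but [x_0] vanishes at the origin without
    being zero. *)
Lemma maximal_nonzero (P : R -> Prop) : is_maximal P -> exists f, P f /\ f <> 0.
Proof.
move=> maxP; apply: NNPP => no.
have P0 f : P f -> f = 0 by move=> Pf; apply: NNPP => f0; apply: no; exists f.
have [|h Ph] := @maximal_inv _ P x maxP; first by move/P0/eqP; rewrite (negPf x_neq0).
have := P0 _ Ph => /(congr1 origin)/eqP.
by rewrite rmorphB rmorphM rmorph1 rmorph0 origin_x mul0r sub0r oppr_eq0 oner_eq0.
Qed.

Hypothesis kinf : infinite_type k.

(** A nonzero element of [P] makes [x_0] and [x_(n-1)] dependent modulo [P]; by the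
    Nullstellensatz each of them is then algebraic modulo [P]. *)
Lemma maximal_algebraic (P : R -> Prop) : is_maximal P ->
  (exists f, f \is monic /\ P (eval1 curve_const x f)) /\
  (exists g, g \is monic /\ P (eval1 curve_const y g)).
Proof.
move=> maxP; have [h [Ph h0]] := maximal_nonzero maxP.
have prP := maximal_is_prime maxP.
have dep := two_dependent curve_embed_inj curve_embed_const _ _ prP Ph h0.
have monic z : (exists f, f != 0 /\ P (eval1 curve_const z f)) ->
    exists f, f \is monic /\ P (eval1 curve_const z f).
  move=> [f [f0 Pf]]; exists ((lead_coef f)^-1%:P * f).
  rewrite monicE mul_polyC lead_coefZ mulVf ?lead_coef_eq0 // eqxx; split=> //.
  by rewrite -mul_polyC rmorphM; case: maxP => -[_ _ PM] _ _; exact: PM.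
split; apply: monic.
  have [G [G0 PG]] := dep x y.
  exact: (algebraic_mod_maximal kinf maxP span_xy G0 PG).
have [G [G0 PG]] := dep y x.
apply: (algebraic_mod_maximal (w := span_mon) kinf maxP _ G0 PG) => E ED Emon.
by apply: span_xy => // c i j t; rewrite [curve_const c * _ * _]mulrAC.
Qed.

Lemma comp_Xd_neq0 (f : {poly k}) : f != 0 -> f \Po 'X^d != 0.
Proof. by rewrite comp_poly_eq0 // size_polyXn ltnS. Qed.

Lemma monic_Xd (g : {poly k}) : g \is monic -> map_poly polyC (g \Po 'X^d) \is monic.
Proof.
move=> gm; rewrite map_monic monicE lead_coef_comp ?size_polyXn //.
by rewrite lead_coefXn expr1n mulr1.
Qed.

Section Saturated.
Hypothesis sat : saturated.

(** In [k[u, v]] the polynomials [f(v^d)] and [g(u^d)] are coprime, so the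
    quotient [q] exists there.  Its products with [f(v^d)] and with [g(u^d)] both
    lie in the coordinate ring, so multiples of [a_0] as well as multiples of
    [a_(n-1)] move the exponents of [q] into the semigroup, and saturation puts
    [q] itself in the ring. *)
Lemma regular_xy (f g : {poly k}) : f \is monic -> g \is monic ->
  forall r, ideal_gen [:: eval1 curve_const y g] (eval1 curve_const x f * r) ->
    ideal_gen [:: eval1 curve_const y g] r.
Proof.
move=> fm gm r /ideal_gen1P [s E].
have E2 : (f \Po 'X^d)%:P * curve_embed r = map_poly polyC (g \Po 'X^d) * curve_embed s.
  by have := congr1 curve_embed E; rewrite !rmorphM /= curve_embed_eval1_x curve_embed_eval1_y.
have [q [rq sq]] := monic_coprime_const (monic_Xd gm) (comp_Xd_neq0 (monic_neq0 fm)) E2.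
have imS z : in_Sgp (curve_embed z) by apply/curve_embed_image; exists z.
have qS : in_Sgp q.
  move=> i j qij.
  have [||e1 E1] := @lowest_term_shift k f q`_i d (SgpN i) d0 (monic_neq0 fm).
  - by move=> j'; exact: SgpN_x.
  - by move=> j'; rewrite -coefCM -sq; exact: imS.
  have [||e2 E2'] := @lowest_term_shift k g (swapXY q)`_j d (SgpN^~ j) d0 (monic_neq0 gm).
  - by move=> i'; exact: SgpN_y.
  - move=> i'; rewrite -coefCM -swapXY_map_polyC -rmorphM /= -rq coef_swapXY.
    exact: imS.
  apply: (sat (i := e1) (j := e2)).
    by rewrite shift_first /=; have := E1 j qij; rewrite /SgpN PoszD PoszM.
  rewrite shift_last /=; have := E2' i; rewrite coef_swapXY => /(_ qij).
  by rewrite /SgpN PoszD PoszM.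
have /curve_embed_image [h hq] := qS.
apply/ideal_gen1P; exists h; apply: curve_embed_inj.
by rewrite rmorphM /= curve_embed_eval1_y hq rq.
Qed.

(** Every maximal ideal has depth two and codimension two.  Both are at most two
    because the ring lies in [k[u, v]]; a regular sequence is given by the
    polynomials in [x_(n-1)] and in [x_0] that the ideal contains, and it provides
    the chain of primes. *)
Lemma saturated_cohen_macaulay : cohen_macaulay R.
Proof.
split; first exact: coord_ring_noetherian.
move=> P maxP; exists 2%N; have [idP nP1 _] := maxP.
have dom := subalgebra_domain curve_embed_inj.
have [[f [f0 Pf]] [g [g0 Pg]]] := maximal_algebraic maxP.
have gy0 : eval1 curve_const y g <> 0.
  move=> /(congr1 curve_embed)/eqP; rewrite curve_embed_eval1_y rmorph0.
  by rewrite (negPf (monic_neq0 (monic_Xd g0))).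
have sP z : z \in [:: eval1 curve_const y g; eval1 curve_const x f] -> P z.
  by rewrite !inE => /orP [] /eqP ->.
have reg : regular_seq [:: eval1 curve_const y g; eval1 curve_const x f].
  split; first by move/(ideal_gen_min idP sP).
  move=> [|[|]] // _ r.
    case: dom => _ _ dom /ideal_gen_nil /dom [//|->]; exact/ideal_gen_nil.
  exact: regular_xy.
split; split.
- by exists [:: eval1 curve_const y g; eval1 curve_const x f].
- by move=> s regs _; exact: depth_le2 curve_embed_inj curve_embed_const s regs.
- apply: (regular_pair_chain (maximal_is_prime maxP) dom Pg Pf gy0).
  exact: regular_xy.
- by move=> r; exact: codim_le2 curve_embed_inj curve_embed_const P r.
Qed.

End Saturated.

(** * Cohen-Macaulay coordinate rings have an empty exceptional set *)

Lemma vec_degree (l : 'I_n) :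
  vec A d l *+ d = a0 *+ (d - tnth A l) + a1 *+ tnth A l.
Proof.
rewrite /vec int_pair_mulrn -[RHS]add0r addrA shiftE (tnth_nth 0%N).
have := exponent_le (ltn_ord l) => la.
by congr (_, _) => /=; rewrite add0r mulrC // subzn.
Qed.

(** Starting at [p - a_0 - a_(n-1)], add generators as long as the result stays
    outside the semigroup.  This ends after fewer than [n d] steps, because then
    some [a_l] has been added [d] times, and [d a_l] contains [a_0] or
    [a_(n-1)], either of which moves the starting point into the semigroup. *)
Lemma socle_point p : E_S A d p -> exists a b : nat, ~ SgpN a b /\
  forall l : 'I_n, SgpN (a + tnth A l) (b + (d - tnth A l)).
Proof.
move=> [_ S0 S1 nS]; pose q := p - a0 - a1.
have Sq0 : Sgp A d (q + a0) by rewrite /q addrAC subrK.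
have Sq1 : Sgp A d (q + a1) by rewrite /q subrK.
have nSq : ~ Sgp A d q by [].
move: q Sq0 Sq1 nSq => {p S0 S1 nS} q Sq0 Sq1 nSq.
have Sl (l : 'I_n) s : Sgp A d s -> Sgp A d (q + (vec A d l *+ d + s)).
  rewrite vec_degree addrA => Ss; apply: semigroup_genD => //.
  have [l0|l0] := posnP (tnth A l).
    have -> : a0 *+ (d - tnth A l) + a1 *+ tnth A l = a0 + a0 *+ d.-1.
      by rewrite l0 subn0 mulr0n addr0 -mulrS prednK.
    rewrite addrA.
    by apply: semigroup_genD => //; apply/semigroup_genMn/Sgp_first.
  rewrite -(prednK l0) mulrS [_ + (a1 + _)]addrCA addrA; apply: semigroup_genD => //.
  by apply: semigroup_genD; apply: semigroup_genMn; [exact: Sgp_first | exact: Sgp_last].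
have [s [Ss nSs Ssv]] : exists s, [/\ Sgp A d s, ~ Sgp A d (q + s) &
    forall l : 'I_n, Sgp A d (q + s + vec A d l)].
  suff H N : forall c : 'I_n -> nat, (n * d <= N + \sum_l c l)%N ->
      ~ Sgp A d (q + \sum_(l < n) vec A d l *+ c l) ->
      exists s, [/\ Sgp A d s, ~ Sgp A d (q + s) &
        forall l : 'I_n, Sgp A d (q + s + vec A d l)].
    apply: (H (n * d)%N (fun=> 0%N)); first exact: leq_addr.
    by rewrite big1 ?addr0.
  (* [N] bounds the number of generators that may still be added. *)
  elim: N => [|N IH] c cN nSc.
    case: nSc; have [l dl] : exists l, (d <= c l)%N.
      apply: NNPP => no; move: cN; rewrite add0n leqNgt; case/negP.
      apply: leq_ltn_trans (_ : \sum_(l < n) d.-1 < _)%N.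
        by apply: leq_sum => l _; rewrite leqNgt; apply/negP => dl; case: no; exists l; lia.
      by rewrite sum_nat_const card_ord ltn_pmul2l; lia.
    rewrite (bigD1 l) //= -(subnKC dl) mulrnDr -addrA.
    apply: Sl; apply: semigroup_genD; first exact/semigroup_genMn/Sgp_vec.
    apply: big_ind => [||i _]; [exact: semigroup_gen0 | exact: semigroup_genD |].
    exact/semigroup_genMn/Sgp_vec.
  have [all|] := classic (forall l : 'I_n,
      Sgp A d (q + \sum_(i < n) vec A d i *+ c i + vec A d l)).
    by exists (\sum_(l < n) vec A d l *+ c l); split=> //; exists c.
  move=> /not_all_ex_not [l nSl].
  apply: (IH (fun i => (i == l) + c i)%N).
    rewrite big_split /= (bigD1 l) //= eqxx big1 => [|i /negPf -> //].
    by rewrite addn0 add1n addnS -addSn.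
  suff -> : \sum_(i < n) vec A d i *+ ((i == l) + c i) =
      \sum_(i < n) vec A d i *+ c i + vec A d l by rewrite addrA.
  under eq_bigr do rewrite mulrnDr.
  rewrite big_split addrC /=; congr (_ + _).
  by rewrite (bigD1 l) //= eqxx big1 ?addr0 // => i /negPf ->.
case: (q + s) nSs Ssv => u v nSuv Suv.
have u0 : 0 <= u by have := S1_ge0 (Sgp_S1 (Suv index_first)); rewrite /= A0 addr0.
have v0 : 0 <= v.
  by have := S2_ge0 (Sgp_S2 (Suv index_last)); rewrite /= Ad subrr addr0.
exists (absz u), (absz v); rewrite /SgpN; split; first by rewrite !gez0_abs.
move=> l; have := Suv l; rewrite !PoszD !gez0_abs // (tnth_nth 0%N).
by rewrite -subzn // exponent_le.
Qed.

Lemma SgpND i j i' j' : SgpN i j -> SgpN i' j' -> SgpN (i + i') (j + j').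
Proof.
move=> S S'; have := semigroup_genD S S'.
by rewrite /SgpN !PoszD.
Qed.

Lemma SgpN_split i j : SgpN i j -> (i, j) != (0%N, 0%N) ->
  exists (l : 'I_n) (i' j' : nat),
    [/\ SgpN i' j', i = (tnth A l + i')%N & j = (d - tnth A l + j')%N].
Proof.
move=> /SgpNP [c [-> ->]] ne.
have [l cl] : exists l, (0 < c l)%N.
  apply: NNPP => no; case/eqP: ne.
  have c0 l : c l = 0%N by apply/eqP; rewrite eqn0Ngt; apply/negP => cl; case: no; exists l.
  by rewrite !big1 // => l _; rewrite c0 muln0.
pose c' m := (c m - (m == l))%N.
have sumE (F : 'I_n -> nat) : (\sum_m F m * c m = F l + \sum_m F m * c' m)%N.
  rewrite (bigD1 l) //= [in RHS](bigD1 l) //= addnA; congr (_ + _)%N.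
    by rewrite /c' eqxx -mulnS subn1 prednK.
  by apply: eq_bigr => m /negPf ml; rewrite /c' ml subn0.
exists l, (\sum_m tnth A m * c' m)%N, (\sum_m (d - tnth A m) * c' m)%N.
by split; [apply/SgpNP; exists c' | exact: sumE | exact: (sumE (fun m => d - tnth A m)%N)].
Qed.

Lemma origin_maximal : is_maximal (fun r => origin r = 0).
Proof.
have [idO nO1 _] := kernel_is_prime origin; split=> // J idJ nJ1 OJ r Jr.
have originK c : origin (curve_const c) = c by rewrite originE curve_embed_const !coefC.
apply: (scalar_in_proper_ideal (kappa := curve_const) idJ nJ1).
rewrite -(subKr r (curve_const _)); apply: ideal_sub => //; apply: OJ.
by rewrite rmorphB originK subrr.
Qed.

(** The prime in the middle is the vanishing ideal of the point [u = 0] of the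
    curve: it contains [x_(n-1)] but not [x_0]. *)
Lemma origin_chain : prime_chain (fun r => origin r = 0) 2.
Proof.
pose f : {rmorphism R -> {poly k}} := horner_eval 0 \o curve_embed.
have fE r : f r = (curve_embed r)`_0 by rewrite /f /= /horner_eval horner_coef0.
exists (fun i => match i with
  | 0 => fun r => r = 0 | 1 => fun r => f r = 0 | _ => fun r => origin r = 0 end).
split=> [[|[|i]] _|[|[|i]] i2|r].
- exact: subalgebra_domain curve_embed_inj.
- exact: kernel_is_prime.
- exact: kernel_is_prime.
- split=> [r ->|]; first exact: rmorph0.
  exists y; split; first by rewrite fE curve_embed_y coefXn ltn_eqF.
  by move/(congr1 curve_embed)/eqP; rewrite curve_embed_y rmorph0 -size_poly_eq0 size_polyXn.
- split=> [r|]; first by rewrite fE originE => ->; rewrite coef0.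
  exists x; split; first exact: origin_x.
  by rewrite fE curve_embed_x coefC /= => /eqP; rewrite -size_poly_eq0 size_polyXn.
- by case: (notF i2).
- exact: iff_refl.
Qed.

(** The monomial [z] at a socle point lies outside the ring, but the irrelevant
    ideal multiplies it into the ring.  This ideal has codimension at least two,
    so it contains a regular sequence beginning with two elements [f], [g]; now
    [g (f z) = f (g z)] makes [f z] a multiple of [f], and [z] would be in the
    ring. *)
Lemma cohen_macaulay_no_E_S : cohen_macaulay R -> forall p, ~ E_S A d p.
Proof.
move=> [_ CM] p Ep; have [a [b [nS Sv]]] := socle_point Ep.
have [r [[[s [sr [_ reg] sm]] _] [_ codim]]] := CM _ origin_maximal.
have := codim _ origin_chain; rewrite -sr.
case: s reg sm {sr} => [|f [|g s]] // reg sm _.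
have mul t : origin t = 0 -> exists T, curve_embed T = plane_mon k a b * curve_embed t.
  rewrite originE => t0; apply/curve_embed_image => i j /coef2M_neq0 [a' [b' [i' [j' [ab tij -> ->]]]]].
  move: ab; rewrite coef_plane_mon; case: andP => [[/eqP -> /eqP ->] _|_]; last by rewrite eqxx.
  have Sij : SgpN i' j' by apply: (_ : in_Sgp (curve_embed t)) => //; apply/curve_embed_image; exists t.
  have ij0 : (i', j') != (0%N, 0%N).
    by apply: contraNneq tij => -[-> ->]; rewrite t0.
  have [l [i2 [j2 [S2' -> ->]]]] := SgpN_split Sij ij0.
  by rewrite !addnA; apply: SgpND.
have [F FE] := mul f (sm f (mem_head _ _)).
have [G GE] := mul g (sm g (mem_behead (s := f :: g :: s) (mem_head _ _))).
have f0 : curve_embed f != 0.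
  apply/eqP => pf; have : f = 0 by apply: curve_embed_inj; rewrite pf rmorph0.
  move=> f0; have := reg 0%N isT 1; rewrite /= f0 mul0r => /(_ _)/ideal_gen_nil/eqP.
  by rewrite oner_eq0 => h; apply: notF; apply: h; apply/ideal_gen_nil.
have gF : g * F = f * G.
  apply: curve_embed_inj; rewrite rmorphM [RHS]rmorphM /= FE GE.
  by move: (curve_embed f) (curve_embed g) (plane_mon k a b) => u v w; ring.
have := reg 1%N isT F; rewrite /= gF => /(_ _)/ideal_gen1P [].
  by apply/ideal_gen1P; exists G.
move=> w Fw; apply: nS.
have zw : plane_mon k a b = curve_embed w.
  by apply: (mulIf f0); rewrite -FE Fw rmorphM; exact: mulrC.
have : in_Sgp (plane_mon k a b) by apply/curve_embed_image; exists w.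
by apply; rewrite coef_plane_mon !eqxx oner_neq0.
Qed.

End Curve.

(** * The equivalences *)

Theorem proposition2p6 (k : fieldType) (n d : nat) (A : n.-tuple nat)
    (r t : nat -> int) :
  infinite_type k ->
  (4 <= n)%N ->
  sorted ltn A ->
  nth 0%N A 0 = 0%N ->
  nth 0%N A n.-1 = d ->
  (\big[gcdn/0%N]_(1 <= i < n) nth 0%N A i)%N = 1%N ->
  Apery_enum (S1 A) d r ->
  Apery_enum (S2 A d) d t ->
  [<-> (* (1) *) cohen_macaulay (coord_ring k A d);
       (* (2) *) forall i, (1 <= i < d)%N -> Sgp A d (r i, t (d - i)%N);
       (* (2), second formulation *)
       forall q1 q2 : int, Apery (S1 A) d q1 -> Apery (S2 A d) d q2 ->
         (q1 + q2 = 0 %[mod d%:Z])%Z -> AP_S A d (q1, q2);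
       (* (3) *) forall p : int * int, AP_S A d p <->
         p = (0, 0) \/ exists2 i, (1 <= i < d)%N & p = (r i, t (d - i)%N);
       (* (4) *) exists s : seq (int * int),
         [/\ uniq s, size s = d & forall p, p \in s <-> AP_S A d p];
       (* (5) *) forall p : int * int, ~ E_S A d p;
       (* (6) *) forall p : int * int, Sgp' A d p <-> Sgp A d p].
Proof.
move=> kinf n4 sA A0 Ad gA rP tP.
have n1 : (1 < n)%N by apply: ltn_trans n4.
have pairP := apery_pairP n1 sA A0 Ad gA rP tP.
tfae.
- move=> CM; apply/(apery_pairs_inP n1 sA A0 Ad gA rP tP) => i id.
  apply/(saturated_Sgp' n1 sA A0 Ad gA); last exact: Sgp'_apery_pair.
  by apply: no_E_S_saturated => //; exact: cohen_macaulay_no_E_S CM.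
- move=> H; apply: (apery_pairs_AP_S n1 sA A0 Ad gA rP tP).
  by apply/apery_pairs_inP.
- by move=> H p; apply: iff_trans (pairP p); exact: AP_S_apery_pairs.
- move=> H; apply: (apery_pairs_count rP) => p.
  exact: iff_trans (H p) (iff_sym (pairP p)).
- exact: (count_no_E_S n1 sA A0 Ad gA rP).
- move=> noE; apply: saturated_Sgp' => //; exact: no_E_S_saturated.
- move=> S'S; apply: saturated_cohen_macaulay => //; exact: Sgp'_saturated.
Qed.
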